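(* Let $\gamma=(\gamma_s)_{s=1}^\infty$ be a sequence with $0<\gamma_s\le \frac{1}{32}$ for all $s$ and $\sum_{s=1}^\infty \gamma_s<\infty$. Let $K(\gamma)$ be the associated Cantor-type set and $h$ the associated dimension function, and suppose that $K(\gamma)$ is non-polar (i.e. has positive logarithmic capacity). Let $\mu_{K(\gamma)}$ be the equilibrium measure of $K(\gamma)$ and let $\Lambda_h$ denote the $h$-Hausdorff measure restricted to $K(\gamma)$. Then the measures $\mu_{K(\gamma)}$ and $\Lambda_h$ are mutually absolutely continuous.
   Context: Notation: $\mathbb{N}=\{1,2,\dots\}$, $\log$ is the natural logarithm. The equilibrium measure of a non-polar compact set is taken in the sense of logarithmic potential theory in $\mathbb{C}$. The set $K(\gamma)$. Given $\gamma=(\gamma_s)_{s=1}^\infty$ with $0<\gamma_s\le\frac1{32}$, let $r_0=1$ and $r_s=\gamma_s r_{s-1}^2$ for $s\in\mathbb{N}$. Define real polynomials by $P_2(x)=x(x-1)$ and $P_{2^{s+1}}=P_{2^s}\cdot(P_{2^s}+r_s)$ for $s\in\mathbb{N}$. For $s\ge 0$ let $E_s=\{x\in\mathbb{R}: P_{2^{s+1}}(x)\le 0\}$. The set $E_s$ is a disjoint union of $2^s$ closed intervals $I_{j,s}$, $1\le j\le 2^s$ (the basic intervals of level $s$), with $E_{s+1}\subset E_s$ and $\max_j |I_{j,s}|\to0$ as $s\to\infty$. Define $K(\gamma)=\bigcap_{s=0}^\infty E_s$. The dimension function $h$. Let $\delta_0=1$ and $\delta_s=\gamma_1\gamma_2\cdots\gamma_s$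 for $s\in\mathbb{N}$. Define $\eta:(0,1]\to[0,\infty)$ by $\eta(\delta_s)=s$ for $s\ge 0$ and $$\eta(t)=s+\frac{\log(\delta_s/t)}{\log(\delta_s/\delta_{s+1})}\quad\text{for } \delta_{s+1}<t<\delta_s,\ s\ge 0.$$ Define $h(0)=0$, $h(t)=2^{-\eta(t)}$ for $0<t\le1$, and $h(t)=1$ for $t>1$. Hausdorff measure. For $E\subset\mathbb{C}$, $$\Lambda_h(E)=\lim_{\delta\to0}\inf\left\{\sum_j h(r_j): E\subset\bigcup_j B(z_j,r_j),\ r_j\le\delta\right\},$$ where the infimum is over countable covers and $B(z,r)$ is the open ball of center $z$ and radius $r$ in $\mathbb{C}$. *)

(* Defs.v *)
From mathcomp Require Import all_boot all_order all_algebra complex.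
From mathcomp Require Import all_classical all_reals all_analysis.
Import Order.TTheory GRing.Theory Num.Theory numFieldNormedType.Exports.

Set Implicit Arguments.
Unset Strict Implicit.
Unset Printing Implicit Defensive.

Local Open Scope classical_set_scope.
Local Open Scope ring_scope.
Local Open Scope complex_scope.

(* The complex plane R[i] with its Borel sigma-algebra; the regular module
   (R[i])^o is what carries the norm topology of R[i]. *)
Definition borelC (R : realType) : measurableType _ :=
  g_sigma_algebraType (open : set (set (R[i])^o)).

Section LogPotential.
Context {R : realType}.
Local Open Scope ereal_scope.
Implicit Types (K : set R[i]) (mu nu : probability (borelC R) R).

(* log (1 / |z - w|), with value +oo on the diagonal (ln 0 = 0 in the
   library). *)
Definition log_kernel (z w : R[i]) : \bar R :=
  if z == w then +oo else (- ln (complex.Re `|z - w|)%R)%:E.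

Definition log_potential mu (z : R[i]) : \bar R :=
  \int[mu]_w log_kernel z w.

Definition log_energy mu : \bar R := \int[mu]_z log_potential mu z.

Definition supported_on K mu := mu (~` K) = 0.

(* For K compact. *)
Definition log_capacity K : \bar R :=
  ereal_sup [set expeR (- log_energy mu) | mu in supported_on K].

Definition non_polar K := 0 < log_capacity K.

(* For K compact and non-polar there is exactly one such measure. *)
Definition is_equilibrium_measure K mu :=
  supported_on K mu /\
  forall nu, supported_on K nu -> log_energy mu <= log_energy nu.

End LogPotential.

Section HausdorffMeasure.
Context {R : realType}.
Local Open Scope ereal_scope.
Implicit Types (h : R -> R) (E : set R[i]).

(* Covers are sequences of balls; since ball z 0 is empty and gauge functions
   vanish at 0, radii equal to 0 account for the finite covers. *)
Definition hausdorff_content h (d : R) E : \bar R :=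
  ereal_inf [set \sum_(0 <= j <oo) (h (r j))%:E |
    r in [set r : nat -> R | (forall j, 0 <= r j <= d)%R /\
      exists z : nat -> (R[i])^o, E `<=` \bigcup_j ball (z j) (r j)%:C]].

Definition hausdorff_measure h E : \bar R :=
  lim (hausdorff_content h d E @[d --> 0^'+]).

Definition hausdorff_measure_on (K : set R[i]) h (A : set (borelC R)) :
  \bar R := hausdorff_measure h (A `&` K).

End HausdorffMeasure.

Section CantorSet.
Context {R : realType}.
(* Only the values gamma s with s >= 1 are used below. *)
Variable gamma : nat -> R.

Fixpoint cantor_r (s : nat) : R :=
  if s is s'.+1 then gamma s * cantor_r s' ^+ 2 else 1.

(* cantor_poly s is P_{2^(s+1)}. *)
Fixpoint cantor_poly (s : nat) : {poly R} :=
  if s is s'.+1 then cantor_poly s' * (cantor_poly s' + (cantor_r s)%:P)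
  else 'X * ('X - 1).

Definition cantor_level (s : nat) : set R :=
  [set x | (cantor_poly s).[x] <= 0].

Definition cantor_set : set R[i] :=
  [set x%:C | x in \bigcap_s cantor_level s].

Definition cantor_delta (s : nat) : R := \prod_(1 <= k < s.+1) gamma k.

(* At t = cantor_delta s the logarithmic term vanishes, so the half-open
   condition also gives eta (delta_s) = s. As (delta_s) decreases strictly
   to 0, there is exactly one such s for every t in ]0, 1]. *)
Definition cantor_eta (t : R) : R :=
  let s := xget 0%N
    [set s | cantor_delta s.+1 < t <= cantor_delta s] in
  s%:R + ln (cantor_delta s / t) / ln (cantor_delta s / cantor_delta s.+1).

Definition cantor_h (t : R) : R :=
  if t <= 0 then 0 else if t <= 1 then 2 `^ (- cantor_eta t) else 1.

End CantorSet.

(* Main.v *)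
Require Import Defs.
From HB Require Import structures.
From mathcomp Require Import all_boot all_order all_algebra complex.
From mathcomp Require Import all_classical all_reals all_analysis.
From mathcomp Require Import measurable_realfun.
From mathcomp Require Import ring lra.
Import Order.TTheory GRing.Theory Num.Theory numFieldNormedType.Exports.

Set Implicit Arguments.
Unset Strict Implicit.
Unset Printing Implicit Defensive.

Local Open Scope classical_set_scope.
Local Open Scope ring_scope.
Local Open Scope complex_scope.

(** Both measures give comparable mass to the natural pieces of the Cantor set,
so each of them bounds the other up to a constant.

Coding.  In the coordinate q = x - 1 the map P_{2^s} is the s-th iterate
[orbit 0 s] of the quadratic maps q |-> q (q + r_s), each of which folds the
interval [- r_s, 0] in two.  The set consists of the points whose orbit never
leaves these intervals, and the side of the critical point - r_s / 2 on which
the orbit lies at each level codes the point by a word of bits.  A cell is the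
set of points of the Cantor set with a prescribed word; the cells of level s
are the traces of the 2^s basic intervals.

The equilibrium measure gives mass 2^-s to every cell of level s
([equilibrium_cell], [minimizer_cell]).  Let nu be the average of the images of
mu under the 2^s inverse branches of P_{2^s} applied after P_{2^s}; it
equidistributes the cells by construction ([lift_exists]).  Since
P_{2^s}(x) - P_{2^s}(y) is the product of x - y' over the 2^s preimages y' of
P_{2^s}(y), the potential of nu at x is 2^-s times the potential of the image
measure at P_{2^s}(x).  Consequently the mutual energy of mu and nu is equal to
the energy of nu, and the energy of mu - nu is the energy of mu minus that of
nu, which is not positive when mu is a minimizer.  The logarithmic kernel is
positive definite, in a form strong enough to conclude mu = nu
([eq_prob_of_energy]).  Positive definiteness is elementary on a set of
diameter one: the convex decreasing function - log d is a mixture of tents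
max (0, rho - d), and a tent is the overlap of two intervals of length rho
([log_ker_mixture]).  It also shows that the energies involved are finite
([mutual_orbit_le]).

Geometry.  The difference of two values of P_{2^s} factors as the difference of
the points times the product of P_{2^k}(x) + P_{2^k}(y) + r_k over k < s
([orbit_diff]).  On a cell each factor lies between r_k (1 - 4 gamma_{k+1}) and
r_k, so cells of level s have diameter at most delta_s divided by the product
of the 1 - 4 gamma_k ([cell_diam]), and two of them are at distance at least
16 delta_s ([cell_gap]).  The product stays away from 0 because the series of
the gamma_k converges; this makes the diameter at most delta_{s-m} for a fixed
m ([cell_diam_uniform]).

Comparison.  A ball whose radius t satisfies delta_{s+1} < t <= delta_s meets
one cell of level s at most, hence has mass at most 2 h(t), and any cover of A
by small balls costs at least half the mass of A ([mu_le_content]).  Conversely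
a null set lies in an open set of small mass; the maximal cells contained in
that open set are disjoint, each is covered by one ball of gauge 2^m times its
mass, and so the null set has covers of arbitrarily small cost
([content_le_open]). *)

(** * Images, averages and null sets of probability measures *)

Section ProbabilityTools.
Context {R : realType}.
Local Open Scope ereal_scope.

Lemma pushforward_exists d d' (T : measurableType d) (T' : measurableType d')
    (P : probability T R) (f : T -> T') : measurable_fun setT f ->
  exists Q : probability T' R, forall A, Q A = P (f @^-1` A).
Proof.
move=> mf; pose X : {mfun T >-> T'} := HB.pack f (isMeasurableFun.Build _ _ _ _ f mf).
by exists (distribution P X).
Qed.

Lemma ge0_integral_law d d' (T : measurableType d) (T' : measurableType d')
    (P : probability T R) (Q : probability T' R) (f : T -> T') (g : T' -> \bar R) :
  measurable_fun setT f -> (forall A, measurable A -> Q A = P (f @^-1` A)) ->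
  measurable_fun setT g -> (forall y, 0 <= g y) ->
  \int[Q]_y g y = \int[P]_x g (f x).
Proof.
move=> mf QP mg g0; rewrite (@eq_measure_integral _ _ _ _ (pushforward P f)).
  by rewrite ge0_integral_pushforward// => y _; exact: g0.
by move=> A mA _; exact: QP.
Qed.

Let half_ge0 : (0 <= 2^-1 :> R)%R. Proof. by rewrite invr_ge0. Qed.
Let half_nng : {nonneg R} := NngNum half_ge0.

Lemma average_exists d (T : measurableType d) (P Q : probability T R) :
  exists S : probability T R, forall A, S A = (2^-1)%R%:E * (P A + Q A).
Proof.
pose m : {measure set T -> \bar R} := mscale half_nng (measure_add P Q).
have mE (A : set T) : m A = (2^-1)%R%:E * (P A + Q A) by rewrite -measure_addE.
have m1 : m setT = 1.
  rewrite mE !probability_setT -EFinD -EFinM; congr EFin.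
  by rewrite mulVf// gt_eqF.
pose S : probability T R := HB.pack (mscale half_nng (measure_add P Q))
  (Measure_isProbability.Build _ _ _ m m1).
by exists S.
Qed.

Lemma ge0_integral_average d (T : measurableType d) (P Q S : probability T R)
    (g : T -> \bar R) :
  (forall A, measurable A -> S A = (2^-1)%R%:E * (P A + Q A)) ->
  measurable_fun setT g -> (forall y, 0 <= g y) ->
  \int[S]_y g y = (2^-1)%R%:E * (\int[P]_y g y + \int[Q]_y g y).
Proof.
move=> SE mg g0.
rewrite (@eq_measure_integral _ _ _ _ (mscale half_nng (measure_add P Q))); last first.
  by move=> A mA _; apply: (eq_trans (SE A mA)); rewrite -measure_addE.
by rewrite ge0_integral_mscale// ge0_integral_measure_add.
Qed.

Lemma ge0_eq_integral_supp d (T : measurableType d) (P : probability T R) (S : set T)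
    (f g : T -> \bar R) : measurable S -> P (~` S) = 0 ->
  measurable_fun setT f -> measurable_fun setT g ->
  (forall x, 0 <= f x) -> (forall x, 0 <= g x) ->
  (forall x, S x -> f x = g x) -> \int[P]_x f x = \int[P]_x g x.
Proof.
move=> mS S0 mf mg f0 g0 fg; apply: ge0_ae_eq_integral => //.
exists (~` S); split => //; first exact: measurableC.
by move=> x /= nfg Sx; apply: nfg => _; exact: fg.
Qed.

Lemma eq_prob_supp d (T : measurableType d) (P : probability T R) (S A B : set T) :
  measurable S -> P (~` S) = 0 -> measurable A -> measurable B ->
  (forall x, S x -> A x <-> B x) -> P A = P B.
Proof.
move=> mS S0 mA mB AB.
have drop C : measurable C -> P C = P (C `&` S).
  move=> mC; rewrite -[in LHS](setUIDK C S) measureU//; first last.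
  - by rewrite setDE setIACA setICr setI0.
  - exact: measurableD.
  - exact: measurableI.
  rewrite [X in _ + X](_ : _ = 0) ?adde0//.
  apply: subset_measure0 S0; [exact: measurableD|exact: measurableC|exact: subIsetr].
rewrite (drop A mA) (drop B mB); congr (P _); apply/seteqP.
by split=> x [Cx Sx]; split=> //; exact/(AB x Sx).
Qed.

End ProbabilityTools.

(** * Outer regularity on the line *)

(** The extension of a premeasure does not change it on the generating intervals. *)
Lemma lebesgue_stieltjes_ocitv (R : realType) (f : cumulative R R) (M : set R) :
  ocitv M -> lebesgue_stieltjes_measure f M = wlength f M.
Proof.
by move=> oM; rewrite /lebesgue_stieltjes_measure /measure_extension measurable_mu_extE.
Qed.

Section OuterRegularity.
Context {R : realType}.
Local Notation TR := (measurableTypeR R).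
Variable k : probability TR R.

(** Continuity from above along the open intervals that shrink to a half-open one. *)
Lemma open_hull (I : set TR) (e : R) : ocitv I -> 0 < e ->
  exists V : set R, [/\ open V, I `<=` V & (k V <= k I + e%:E)%E].
Proof.
move=> /ocitvP[->|[[a b] /= ab ->]] e0.
  by exists set0; split=> //; rewrite !measure0 add0e lee_fin ltW.
pose F n : set TR := `]a, b + n.+1%:R^-1[%classic.
have capF : \bigcap_n F n = `]a, b]%classic.
  apply/seteqP; split=> x /=.
    rewrite in_itv/= => xF; have := xF 0%N Logic.I; rewrite /F /= in_itv/= => /andP[-> _] /=.
    rewrite leNgt; apply/negP => bx; have bx0 : 0 < x - b by rewrite subr_gt0.
    pose n := Num.truncn (x - b)^-1.
    have := xF n Logic.I; rewrite /F /= in_itv/= -ltrBlDl => /andP[_ xn].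
    have : (x - b)^-1 < n.+1%:R by exact: truncnS_gt.
    rewrite -[ltRHS]invrK ltf_pV2 ?posrE ?invr_gt0 ?ltr0n// => /(lt_trans xn).
    by rewrite ltxx.
  rewrite in_itv/= => /andP[ax xb] n _; rewrite /F /= in_itv/= ax (le_lt_trans xb)//.
  by rewrite ltrDl invr_gt0 ltr0n.
have cvF : k (F n) @[n --> \oo] --> k `]a, b]%classic.
  rewrite -capF; apply: nonincreasing_cvg_mu.
  - by rewrite -ge0_fin_numE// fin_num_measure//; exact: measurable_itv.
  - by move=> n; exact: measurable_itv.
  - by rewrite capF; exact: measurable_itv.
  - move=> m n mn; apply/subsetPset => x; rewrite /F /= !in_itv/= => /andP[-> /lt_le_trans]; apply.
    by rewrite lerD2l lef_pV2 ?posrE ?ltr0n// ler_nat.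
have [n kFn] : exists n, (k (F n) <= k `]a, b]%classic + e%:E)%E.
  apply: contrapT => /forallNP no.
  have : (k `]a, b]%classic + e%:E <= k `]a, b]%classic)%E.
    rewrite -{2}(cvg_lim _ cvF)//; apply: lime_ge; first by apply/cvg_ex; eexists; exact: cvF.
    by near=> n; rewrite leNgt; apply/negP => /ltW; exact: no.
  rewrite -[leRHS]adde0 leeD2lE ?fin_num_measure// lee_fin leNgt e0//.
exists (F n); split=> //.
move=> x; rewrite /F /= !in_itv/= => /andP[-> xb]; rewrite (le_lt_trans xb)//.
by rewrite ltrDl invr_gt0 ltr0n.
Unshelve. all: by end_near. Qed.

(** A probability on the line is the Lebesgue-Stieltjes measure of its distribution
function, that is, an infimum over covers by half-open intervals; each of these
is then enlarged to an open set at a summable cost. *)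
Lemma null_set_open_cover (A : set TR) (e : R) : measurable A -> k A = 0%E -> 0 < e ->
  exists U : set R, [/\ open U, A `<=` U & (k U <= e%:E)%E].
Proof.
move=> mA kA e0; have := lebesgue_stieltjes_cdf_id k mA.
set f := (X in lebesgue_stieltjes_measure X) => fA.
have kM (M : set TR) : ocitv M -> wlength f M = k M.
  move=> oM; rewrite -lebesgue_stieltjes_ocitv//.
  by apply: (lebesgue_stieltjes_cdf_id k); exact: sub_sigma_algebra.
have /ereal_inf_lt[_ [/= M [mM AM] <-] sM] : (lebesgue_stieltjes_measure f A < (e / 2)%:E)%E.
  by rewrite fA kA lte_fin divr_gt0.
pose e2 n := e / 2 / (2 ^ n.+1)%:R.
have e2_gt0 n : 0 < e2 n by rewrite !divr_gt0// ltr0n expn_gt0.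
have /choice[V VP] n : exists V : set R,
    [/\ open V, M n `<=` V & (k V <= k (M n) + (e2 n)%:E)%E].
  by apply: open_hull => //; exact: mM.
exists (\bigcup_n V n); split.
- by apply: bigcup_open => n _; have [] := VP n.
- move=> x /AM[n _ Mnx]; exists n => //; have [_ + _] := VP n; exact.
have mV n : measurable (V n : set TR) by apply: open_measurable; have [] := VP n.
apply: (@le_trans _ _ (\sum_(n <oo) k (V n))%E).
  apply: measure_sigma_subadditive => //; exact: bigcup_measurable.
apply: (@le_trans _ _ (\sum_(n <oo) (k (M n) + (e2 n)%:E))%E).
  by apply: lee_nneseries => // n _; have [] := VP n.
apply: (@le_trans _ _ (\sum_(n <oo) k (M n) + (e / 2)%:E)%E).
  by apply: epsilon_trick => //; rewrite divr_ge0// ltW.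
rewrite [leRHS](_ : _ = ((e / 2)%:E + (e / 2)%:E)%E); last by rewrite -EFinD -splitr.
rewrite leeD2r// ltW// (le_lt_trans _ sM)// le_eqVlt; apply/orP; left; apply/eqP.
by apply: eq_eseriesr => n _; rewrite kM//; exact: mM.
Qed.

End OuterRegularity.

(** * Energies for mixtures of rank-one kernels *)

Section RankOneMixture.
Context d d' (T : measurableType d) (X : measurableType d') {R : realType}.
Variable theta : {sigma_finite_measure set T -> \bar R}.
Variable phi : T -> X -> R.
Hypothesis mphi : measurable_fun [set: T * X] (fun p => phi p.1 p.2).
Hypothesis phi_ge0 : forall t x, 0 <= phi t x.
Hypothesis phi_bounded : forall t, exists M, forall x, phi t x <= M.
Local Open Scope ereal_scope.
Implicit Types k l : probability X R.

Definition mean k (t : T) : \bar R := \int[k]_x (phi t x)%:E.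

Lemma mean_ge0 k t : 0 <= mean k t.
Proof. by apply: integral_ge0 => x _; rewrite lee_fin. Qed.

Lemma measurable_phi1 t : measurable_fun [set: X] (phi t).
Proof. exact: (measurableT_comp mphi (pair1_measurable t)). Qed.

Lemma measurable_phi_swap : measurable_fun [set: X * T] (fun p => phi p.2 p.1).
Proof.
exact: (measurableT_comp mphi (measurable_fun_pair measurable_snd measurable_fst)).
Qed.

Lemma measurable_phi2 x : measurable_fun [set: T] (phi^~ x).
Proof. exact: (measurableT_comp mphi (pair2_measurable x)). Qed.

Lemma mean_fin k t : mean k t \is a fin_num.
Proof.
rewrite ge0_fin_numE ?mean_ge0//; have [M hM] := phi_bounded t.
apply: (@le_lt_trans _ _ (\int[k]_x (cst M%:E) x)).
  apply: ge0_le_integral => //.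
  - by move=> x _; rewrite lee_fin.
  - by apply/measurable_EFinP; exact: measurable_phi1.
  - by move=> x _; rewrite lee_fin.
by rewrite integral_cst//= probability_setT mule1 ltry.
Qed.

Lemma measurable_mean k : measurable_fun [set: T] (mean k).
Proof.
apply: (@measurable_fun_fubini_tonelli_F _ _ _ _ _ k (fun p => (phi p.1 p.2)%:E)).
  exact/measurable_EFinP.
by move=> p; rewrite lee_fin.
Qed.

(** Positive definite, because its quadratic form is an integral of squares. *)
Definition mixture (x y : X) : \bar R := \int[theta]_t (phi t x * phi t y)%:E.

Lemma mixture_potential l x :
  \int[l]_y mixture x y = \int[theta]_t ((phi t x)%:E * mean l t).
Proof.
rewrite /mixture.
rewrite (@fubini_tonelli _ _ _ _ _ l theta (fun p => (phi p.2 x * phi p.2 p.1)%:E))/=.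
- apply: eq_integral => t _; under eq_integral do rewrite EFinM.
  rewrite ge0_integralZl ?lee_fin//; first by apply/measurable_EFinP; exact: measurable_phi1.
  by move=> y _; rewrite lee_fin.
- apply/measurable_EFinP; apply: measurable_funM.
    exact: (measurableT_comp (measurable_phi2 x) measurable_snd).
  exact: measurable_phi_swap.
- by move=> p; rewrite lee_fin mulr_ge0.
Qed.

(** Tonelli, once in each variable: the bilinear form of a mixture is the integral
of the products of the means. *)
Lemma mixture_mutual k l :
  \int[k]_x \int[l]_y mixture x y = \int[theta]_t (mean k t * mean l t).
Proof.
under eq_integral do rewrite mixture_potential.
rewrite (@fubini_tonelli _ _ _ _ _ k theta (fun p => (phi p.2 p.1)%:E * mean l p.2))/=.
- apply: eq_integral => t _; rewrite /fubini_G /=.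
  rewrite ge0_integralZr ?mean_ge0//; first by apply/measurable_EFinP; exact: measurable_phi1.
  by move=> x _; rewrite lee_fin.
- apply: emeasurable_funM.
    by apply/measurable_EFinP; exact: measurable_phi_swap.
  exact: (measurableT_comp (measurable_mean l) measurable_snd).
- by move=> p; rewrite mule_ge0 ?lee_fin ?mean_ge0.
Qed.

Lemma measurable_meanM k l : measurable_fun [set: T] (fun t => mean k t * mean l t).
Proof. by apply: emeasurable_funM; exact: measurable_mean. Qed.

Lemma meanM_ge0 k l t : 0 <= mean k t * mean l t.
Proof. by rewrite mule_ge0 ?mean_ge0. Qed.

Definition mean_gap k l t : \bar R := ((fine (mean k t) - fine (mean l t)) ^+ 2)%:E.

(** The polarization a^2 + b^2 = 2 a b + (a - b)^2 under the integral sign.  It is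
stated without subtraction because the energies may be infinite. *)
Lemma mixture_gap k l :
  \int[k]_x \int[k]_y mixture x y + \int[l]_x \int[l]_y mixture x y =
  2%:E * \int[k]_x \int[l]_y mixture x y + \int[theta]_t mean_gap k l t.
Proof.
have mf m : measurable_fun [set: T] (fun t => fine (mean m t)).
  by apply: measurableT_comp => //; exact: measurable_mean.
have mgap : measurable_fun [set: T] (mean_gap k l).
  by apply/measurable_EFinP; apply: measurable_funX; apply: measurable_funB.
rewrite !mixture_mutual -ge0_integralZl//; last 2 first.
- exact: measurable_meanM.
- by move=> t _; exact: meanM_ge0.
rewrite -ge0_integralD//; last 4 first.
- by move=> t _; exact: meanM_ge0.
- exact: measurable_meanM.
- by move=> t _; exact: meanM_ge0.
- exact: measurable_meanM.
rewrite -ge0_integralD//; first last.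
- by move=> t _; rewrite lee_fin sqr_ge0.
- by apply: emeasurable_funM => //; exact: measurable_meanM.
- by move=> t _; rewrite mule_ge0 ?meanM_ge0.
apply: eq_integral => t _; rewrite /mean_gap.
rewrite -(fineK (mean_fin k t)) -(fineK (mean_fin l t)) /=.
by rewrite -!EFinM -!EFinD; congr EFin; ring.
Qed.

Lemma mixture_mutual_le k l :
  2%:E * \int[k]_x \int[l]_y mixture x y <=
  \int[k]_x \int[k]_y mixture x y + \int[l]_x \int[l]_y mixture x y.
Proof.
rewrite mixture_gap leeDl// integral_ge0// => t _.
by rewrite lee_fin sqr_ge0.
Qed.

(** The equality case: when the mutual energy is finite it can be cancelled in
[mixture_gap]. *)
Lemma integral_mean_gap0 k l :
  \int[k]_x \int[l]_y mixture x y < +oo ->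
  \int[k]_x \int[k]_y mixture x y + \int[l]_x \int[l]_y mixture x y <=
    2%:E * \int[k]_x \int[l]_y mixture x y ->
  \int[theta]_t mean_gap k l t = 0.
Proof.
move=> fin; rewrite mixture_gap; set A := 2%:E * _.
have A0 : 0 <= A.
  by rewrite mule_ge0// mixture_mutual integral_ge0// => t _; rewrite meanM_ge0.
have Af : A \is a fin_num by rewrite ge0_fin_numE// /A lte_mul_pinfty.
rewrite -[leRHS]adde0 leeD2lE// => h; apply/eqP; rewrite eq_le h/=.
by rewrite integral_ge0// => t _; rewrite lee_fin sqr_ge0.
Qed.

End RankOneMixture.

(** * The logarithmic kernel as a mixture of boxes *)

Section LogKernel.
Context {R : realType}.
Local Notation leb := (@lebesgue_measure R).
Local Notation TR := (measurableTypeR R).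

(** log (1 / |d|), truncated at 0 for |d| >= 1.  On a set of diameter one the
truncation changes nothing, and elsewhere it keeps all integrands nonnegative
and the kernel positive definite. *)
Definition log_ker (d : R) : \bar R :=
  if d == 0 then +oo%E else (Num.max 0 (- ln `|d|))%:E.

(** The density in rho of the mixture: for rho < 1 the tent of width rho with weight
1 / rho^2, the second derivative of - log; the range 1 <= rho < 2 carries the
tent of width one, with the unit mass given by the jump of the slope of
max (0, - log) at 1. *)
Definition tent (d rho : R) : R :=
  if 0 < rho < 2 then (Num.min rho 1)^-1 ^+ 2 * Num.max 0 (Num.min rho 1 - d) else 0.

Lemma tent_ge0 d rho : 0 <= tent d rho.
Proof.
rewrite /tent; case: ifP => // _; rewrite mulr_ge0 ?sqr_ge0//.
by rewrite le_max lexx.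
Qed.

(** Away from 0 the inverse is exp (- log |x|) up to sign. *)
Lemma measurable_invr : measurable_fun [set: R] (fun x : R => x^-1).
Proof.
have -> : (fun x : R => x^-1) = (fun x => if x == 0 then 0 else
    if 0 < x then expR (- ln x) else - expR (- ln (- x))).
  apply/funext => x; case: eqVneq => [->|x0]; first by rewrite invr0.
  case: ltP => x0'; first by rewrite expRN lnK.
  by rewrite expRN lnK ?invrN ?opprK// posrE oppr_gt0 lt_neqAle x0.
have mE (f : R -> R) : measurable_fun setT f ->
    measurable_fun setT (fun x => expR (- ln (f x))).
  move=> mf; apply: (measurableT_comp (@measurable_expR R)).
  by apply: measurable_funN; exact: (measurableT_comp (@measurable_ln R) mf).
apply: measurable_fun_ifT => //; first by apply: measurable_fun_eqr.
apply: measurable_fun_ifT => //; first exact: measurable_fun_ltr.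
- exact: mE.
- by apply: measurable_funN; apply: mE; exact: measurable_funN.
Qed.

Lemma continuous_tent_left (d : R) : 0 < d ->
  {within `[d, 1], continuous (fun x => (x - d) / x ^+ 2)}.
Proof.
move=> d0; apply: continuous_in_subspaceT => x; rewrite inE/= in_itv/= => /andP[dx _].
have x0 : 0 < x by exact: lt_le_trans dx.
apply: cvgM; first by apply: cvgB; [exact: cvg_id|exact: cvg_cst].
apply: cvgV; first by rewrite sqrf_eq0 gt_eqF.
exact: exprn_continuous.
Qed.

(** The antiderivative of (x - d) / x^2 is log x + d / x. *)
Lemma integral_tent_left (d : R) : 0 < d < 1 ->
  (\int[leb]_(x in `[d, 1%R]) ((x - d) / x ^+ 2)%:E = (- ln d - 1 + d)%:E)%E.
Proof.
move=> /andP[d0 d1].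
pose F (x : R) : R := ln x + d * x^-1.
have dF (x : R) : 0 < x -> is_derive x 1 F ((x - d) / x ^+ 2).
  move=> x0; have xn0 : x != 0 by rewrite gt_eqF.
  have h := is_deriveD (is_derive1_ln x0) (is_deriveZ d (is_deriveV xn0 (is_derive_id x (1 : R)))).
  by apply: (is_derive_eq h); rewrite /GRing.scale /=; field.
have cF (x : R) : 0 < x -> {for x, continuous F}.
  by move=> x0; apply/differentiable_continuous/derivable1_diffP; have [] := dF x x0.
rewrite (@continuous_FTC2 _ (fun x => (x - d) / x ^+ 2) F)//.
- by rewrite -EFinB /F ln1 invr1; congr EFin; field; rewrite gt_eqF.
- exact: continuous_tent_left.
- split.
  + move=> x; rewrite in_itv/= => /andP[dx _].
    by have [] := dF x (lt_trans d0 dx).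
  + exact/cvg_at_right_filter/cF.
  + exact/cvg_at_left_filter/cF.
- move=> x; rewrite in_itv/= => /andP[dx _].
  rewrite derive1E. by have [_ ->] := dF x (lt_trans d0 dx).
Qed.

Lemma measurable_tent d : measurable_fun [set: R] (tent d).
Proof.
apply: measurable_fun_ifT => //.
  by apply: measurable_and; exact: measurable_fun_ltr.
apply: measurable_funM.
  apply: measurable_funX; apply: (measurableT_comp measurable_invr).
  exact: measurable_minr.
apply: measurable_maxr => //; apply: measurable_funB => //.
exact: measurable_minr.
Qed.

Lemma tent_anti d e rho : d <= e -> tent e rho <= tent d rho.
Proof.
move=> de; rewrite /tent; case: ifP => // _.
rewrite ler_wpM2l ?sqr_ge0// ge_max le_max lexx/= le_max.
by apply/orP; right; rewrite lerB.
Qed.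

(** The part rho <= 1 contributes - log d - 1 + d and the part 1 < rho < 2
contributes 1 - d. *)
Lemma integral_tent01 d : 0 < d < 1 -> (\int[leb]_rho (tent d rho)%:E = (- ln d)%:E)%E.
Proof.
move=> /andP[d0 d1].
have -> : (\int[leb]_rho (tent d rho)%:E = \int[leb]_rho
    (((fun x => ((x - d) / x ^+ 2)%:E) \_ `[d, 1%R]) rho +
     (cst (1 - d)%:E \_ `]1%R, 2%R[) rho))%E.
  apply: eq_integral => x _; rewrite /tent !patchE !mem_setE !in_itv/=.
  have [x0|x0] := ltP 0 x; last first.
    have -> : (d <= x) = false by apply/negbTE; rewrite -ltNge (le_lt_trans x0).
    have -> : (1 < x) = false by apply/negbTE; rewrite -leNgt (le_trans x0).
    by rewrite adde0.
  have [x1|x1] := leP x 1; rewrite /= ?andbT ?andbF ?adde0 ?add0e.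
    rewrite ifT; last by rewrite (le_lt_trans x1)// ltr1n.
    case: ifPn => [dx|].
      by rewrite max_r ?subr_ge0// exprVn mulrC.
    by rewrite -ltNge => dx; rewrite max_l ?mulr0// subr_le0 ltW.
  case: ifPn => // _; rewrite invr1 expr1n mul1r max_r// subr_ge0 ltW//.
have m1 : measurable_fun `[d, 1%R] (fun x : R => ((x - d) / x ^+ 2)%:E).
  apply/measurable_EFinP; apply: subspace_continuous_measurable_fun => //.
  exact: continuous_tent_left.
rewrite ge0_integralD//; last 4 first.
- move=> x _; rewrite patchE; case: ifPn => //; rewrite inE/= in_itv/= => /andP[dx _].
  by rewrite lee_fin mulr_ge0 ?subr_ge0// invr_ge0 sqr_ge0.
- by apply/(measurable_restrict _ _ _) => //; rewrite setTI.
- move=> x _; rewrite patchE; case: ifPn => // _.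
  by rewrite lee_fin subr_ge0 ltW.
- by apply/(measurable_restrict _ _ _) => //; exact: measurable_cst.
rewrite -!integral_mkcond integral_tent_left ?d0// integral_cst//=.
rewrite lebesgue_measure_itv/= lte_fin ltr1n/= -EFinB -EFinM -EFinD.
by congr EFin; ring.
Qed.

(** At d = 0 the value is infinite because it dominates - log e for all e > 0. *)
Lemma integral_tent d : 0 <= d -> (\int[leb]_rho (tent d rho)%:E = log_ker d)%E.
Proof.
rewrite /log_ker le_eqVlt eq_sym; case: eqVneq => [-> _|dn0 /= d0].
  apply/eqyP => A A0.
  (* the value of e for which - log e = A *)
  pose e := expR (- A).
  have e01 : 0 < e < 1 by rewrite expR_gt0 expR_lt1 oppr_lt0.
  have -> : A = - ln e by rewrite expRK opprK.
  rewrite -integral_tent01//; apply: ge0_le_integral => //.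
  - by move=> x _; rewrite lee_fin tent_ge0.
  - by apply/measurable_EFinP; exact: measurable_tent.
  - by apply/measurable_EFinP; exact: measurable_tent.
  - by move=> x _; rewrite lee_fin tent_anti// ltW; case/andP: e01.
rewrite gtr0_norm//; have [d1|d1] := ltP d 1.
  by rewrite integral_tent01 ?d0// max_r// oppr_ge0 ln_le0// ltW.
rewrite max_l ?oppr_le0 ?ln_ge0//; apply: integral0_eq => rho _.
rewrite /tent; case: ifP => // _; rewrite max_l ?mulr0// subr_le0.
by rewrite (le_trans _ d1)// ge_min lexx orbT.
Qed.

(** The parameter t = (u, rho) stands for the interval that starts at u and has
length min (rho, 1). *)
Definition box_fun (t : TR * TR) (x : TR) : R :=
  if (0 < t.2 < 2) && (t.1 <= x <= t.1 + Num.min (t.2 : R) 1) then (Num.min (t.2 : R) 1)^-1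
  else 0.

Lemma box_fun_ge0 t x : 0 <= box_fun t x.
Proof.
rewrite /box_fun; case: ifP => // /andP[/andP[t0 _] _].
by rewrite invr_ge0 le_min (ltW t0) ler01.
Qed.

Lemma box_fun_bounded t : exists M, forall x, box_fun t x <= M.
Proof.
exists `|(Num.min (t.2 : R) 1)^-1| => x; rewrite /box_fun; case: ifP => // _.
exact: ler_norm.
Qed.

Lemma measurable_box_fun : measurable_fun [set: (TR * TR) * TR] (fun p => box_fun p.1 p.2).
Proof.
have m1 : measurable_fun [set: (TR * TR) * TR] (fun p => p.1.2).
  exact: measurableT_comp measurable_snd measurable_fst.
have m2 : measurable_fun [set: (TR * TR) * TR] (fun p => p.1.1).
  exact: measurableT_comp measurable_fst measurable_fst.
have mm : measurable_fun [set: (TR * TR) * TR] (fun p => Num.min p.1.2 1).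
  exact: measurable_minr.
apply: measurable_fun_ifT => //.
  apply: measurable_and; apply: measurable_and.
  - exact: measurable_fun_ltr.
  - exact: measurable_fun_ltr.
  - by apply: measurable_fun_ler => //; exact: measurable_snd.
  - by apply: measurable_fun_ler; [exact: measurable_snd|exact: measurable_funD].
exact: (measurableT_comp measurable_invr mm).
Qed.

(** The product measure under a name of its own, so that it can carry a sigma-finite
structure. *)
Definition leb2 : set (TR * TR)%type -> \bar R :=
  (leb \x leb)%E.

HB.instance Definition _ := Measure.on leb2.

Let leb2_sigma_finite : sigma_finite setT leb2.
Proof.
exists (fun n => `[- n%:R, n%:R]%classic `*` `[- n%:R, n%:R]%classic).
  apply/esym; rewrite -subTset => -[x y] _.
  exists (Num.truncn (Num.max `|x| `|y|)).+1 => //=; rewrite !in_itv/= -!ler_norml.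
  by split; apply: ltW; apply: le_lt_trans (truncnS_gt _); rewrite le_max lexx ?orbT.
move=> n; split; first by apply: measurableX.
have fin : (leb `[(- n%:R)%R, n%:R] < +oo)%E.
  by rewrite lebesgue_measure_itv/=; case: ifP => //; rewrite -EFinB ltry.
by rewrite /leb2 product_measure1E// lte_mul_pinfty// ge0_fin_numE.
Qed.

HB.instance Definition _ := Measure_isSigmaFinite.Build _ _ _ leb2 leb2_sigma_finite.

(** The positions u for which an interval of length m contains both x and y form an
interval of length m - |x - y|; integrating over u gives a tent, and integrating
the tents over rho gives the logarithm. *)
Lemma log_ker_mixture (x y : R) :
  log_ker `|x - y| = mixture leb2 box_fun x y.
Proof.
rewrite /mixture /leb2 fubini_tonelli2/=; last 2 first.
- apply/measurable_EFinP; apply: measurable_funM.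
    exact: (measurable_phi2 measurable_box_fun x).
  exact: (measurable_phi2 measurable_box_fun y).
- by move=> t; rewrite lee_fin mulr_ge0// box_fun_ge0.
rewrite -integral_tent ?normr_ge0//; apply: eq_integral => rho _.
rewrite /fubini_G /= /box_fun /= /tent; case: ifP => [/andP[rho0 _]|_] /=; last first.
  by rewrite integral0_eq// => u _; rewrite mul0r.
set m := Num.min rho 1.
have m0 : 0 < m by rewrite lt_min rho0 ltr01.
pose J := `[Num.max x y - m, Num.min x y]%classic : set R.
transitivity (\int[leb]_u ((m^-1 ^+ 2) * \1_J u)%:E)%E; last first.
  apply: eq_integral => u _; rewrite indicE mem_setE in_itv/= lerBlDr ge_max le_min.
  case: (leP u x) => ux; case: (leP u y) => uy; rewrite ?andbF ?mul0r ?mulr0 //=.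
  case: (leP x (u + m)) => xu; case: (leP y (u + m)) => yu; rewrite ?mul0r ?mulr0//=.
  by rewrite mulr1 expr2.
under eq_integral do rewrite EFinM.
rewrite ge0_integralZl//; last 2 first.
- by apply/measurable_EFinP; apply: measurable_indic; exact: measurable_itv.
- by rewrite lee_fin sqr_ge0.
rewrite integral_indic//; last exact: measurable_itv.
have lJ : leb J = if Num.max x y - m < Num.min x y
    then (Num.min x y - (Num.max x y - m))%:E else 0%E.
  by rewrite /J lebesgue_measure_itv/= lte_fin.
rewrite setIT EFinM; congr (_ * _)%E; apply/esym/(eq_trans lJ).
have -> : Num.max x y - m = Num.min x y + (`|x - y| - m) by rewrite maxr_absE minr_absE; lra.
rewrite gtrDl subr_lt0; case: ifPn => h; last first.
  by rewrite max_l// subr_le0 leNgt.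
by rewrite max_r ?subr_ge0 1?ltW//; congr EFin; lra.
Qed.

End LogKernel.

(** * Positive definiteness of the logarithmic energy *)

Section EnergyUniqueness.
Context {R : realType}.
Local Notation leb := (@lebesgue_measure R).
Local Notation TR := (measurableTypeR R).
Implicit Types k l : probability TR R.

Definition mutual k l : \bar R := (\int[k]_x \int[l]_y log_ker (x - y))%E.

Lemma log_ker_norm (d : R) : log_ker `|d| = log_ker d.
Proof. by rewrite /log_ker normr_eq0 normr_id. Qed.

Lemma log_ker_ge0 (d : R) : (0 <= log_ker d)%E.
Proof. by rewrite /log_ker; case: ifP => // _; rewrite lee_fin le_max lexx. Qed.

Lemma log_kerN (d : R) : log_ker (- d) = log_ker d.
Proof. by rewrite -log_ker_norm normrN log_ker_norm. Qed.

Lemma mutual_mixture k l :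
  mutual k l = (\int[k]_x \int[l]_y mixture leb2 box_fun x y)%E.
Proof.
apply: eq_integral => x _; apply: eq_integral => y _.
by rewrite -log_ker_mixture log_ker_norm.
Qed.

(** Positive definiteness: by [log_ker_mixture] the kernel is a mixture of rank-one
kernels. *)
Lemma mutual_le k l : (2%:E * mutual k l <= mutual k k + mutual l l)%E.
Proof.
rewrite !mutual_mixture; apply: mixture_mutual_le.
- exact: measurable_box_fun.
- exact: box_fun_ge0.
- exact: box_fun_bounded.
Qed.

Lemma mean_box_fun k (u rho : R) : 1 < rho < 2 ->
  mean box_fun k (u, rho) = k `[u, u + 1]%classic.
Proof.
move=> /andP[r1 r2]; rewrite /mean.
transitivity (\int[k]_x (\1_(`[u, u + 1]%classic) x)%:E)%E.
  apply: eq_integral => x _; rewrite /box_fun /= (lt_trans ltr01 r1) r2/=.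
  by rewrite (min_r (ltW r1)) invr1 indicE mem_setE in_itv/=; case: ifP.
by rewrite integral_indic ?setIT.
Qed.

(** In the equality case the gap vanishes for almost every box.  For 1 < rho < 2 the
box does not depend on rho, so the intervals of length one already agree for
almost every starting point, hence for a dense set of them. *)
Lemma dense_unit_interval_mass_eq k l : (mutual k l < +oo)%E ->
  (mutual k k + mutual l l <= 2%:E * mutual k l)%E ->
  forall a b : R, a < b -> exists u : R, a < u < b /\
    k `[u, u + 1]%classic = l `[u, u + 1]%classic.
Proof.
rewrite !mutual_mixture => fin le_kl a b ab.
have mgap : measurable_fun setT (mean_gap box_fun k l).
  have mf (m : probability TR R) : measurable_fun setT (fun t => fine (mean box_fun m t)).
    apply: measurableT_comp => //; apply: measurable_mean.
      exact: measurable_box_fun.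
    exact: box_fun_ge0.
  by apply/measurable_EFinP; apply: measurable_funX; apply: measurable_funB.
have gap_ge0 t : (0 <= mean_gap box_fun k l t)%E by rewrite lee_fin sqr_ge0.
have := integral_mean_gap0 measurable_box_fun box_fun_ge0 box_fun_bounded fin le_kl.
rewrite /leb2 fubini_tonelli2// => gap0.
have r32 : 1 < (3 / 2 : R) < 2 by apply/andP; split; lra.
(* any rho in ]1, 2[ would do *)
pose gap1 (u : R) : \bar R := mean_gap box_fun k l (u, 3 / 2).
have mgap1 : measurable_fun setT gap1.
  exact: (measurableT_comp mgap (pair2_measurable _)).
have int0 : (\int[leb]_u gap1 u = 0)%E.
  apply/eqP; rewrite eq_le integral_ge0 ?andbT; last by move=> u _; exact: gap_ge0.
  apply: (@le_trans _ _ (\int[leb]_(rho in `]1%R, 2%R[) \int[leb]_u gap1 u)%E).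
    rewrite integral_cst//= lebesgue_measure_itv/= lte_fin ltr1n -EFinB.
    by rewrite (_ : 2 - 1 = 1)%R ?mule1//; lra.
  apply: (@le_trans _ _ (\int[leb]_(rho in `]1%R, 2%R[)
      fubini_G leb (mean_gap box_fun k l) rho)%E).
    rewrite le_eqVlt; apply/orP; left; apply/eqP; apply: eq_integral => rho.
    rewrite inE/= in_itv/= => h; apply: eq_integral => u _.
    rewrite /gap1 /mean_gap !mean_box_fun//.
  rewrite -[leRHS]gap0; apply: ge0_subset_integral => //.
    by apply: measurable_fun_fubini_tonelli_G.
  by move=> rho _; apply: integral_ge0.
have [N [mN N0 subN]] : ae_eq leb setT gap1 (cst 0%E).
  apply/ae_eq_integral_abs => //; rewrite -[RHS]int0.
  by apply: eq_integral => u _; rewrite gee0_abs// gap_ge0.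
apply: contrapT => /forallNP noU.
have abN : `]a, b[%classic `<=` N.
  move=> u /=; rewrite in_itv/= => uab; apply: subN => /= /(_ Logic.I).
  rewrite /gap1 /mean_gap !mean_box_fun//.
  move=> [] /eqP; rewrite sqrf_eq0 subr_eq0 => /eqP h.
  apply: (noU u); split => //.
  by rewrite -[LHS]fineK ?fin_num_measure// h fineK ?fin_num_measure.
have : (leb `]a, b[%classic <= leb N)%E by apply: le_measure => //; rewrite inE.
by rewrite N0 lebesgue_measure_itv/= lte_fin ab -EFinB lee_fin subr_le0 leNgt ab.
Qed.

(** The rays at which the two measures agree form a pi-system; its sigma-algebra
contains every ray because rays are intersections of sequences of larger ones. *)
Lemma eq_prob_of_dense_cdf k l :
  (forall x y : R, x < y -> exists2 u : R, x < u < y &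
    k `]-oo, u]%classic = l `]-oo, u]%classic) ->
  (forall n : nat, k `]-oo, n%:R]%classic = l `]-oo, n%:R]%classic) ->
  forall A, measurable A -> k A = l A.
Proof.
move=> dense good_nat A mA.
pose good (u : R) := k `]-oo, u]%classic = l `]-oo, u]%classic.
pose G : set (set TR) := [set B | exists2 u : R, good u & B = `]-oo, u]%classic].
have ray (x : R) : <<s G >> `]-oo, x]%classic.
  have h n : {u : R | x < u < x + n.+1%:R^-1 & good u}.
    apply: cid2; apply: dense; by rewrite ltrDl invr_gt0 ltr0n.
  have -> : `]-oo, x]%classic = \bigcap_n `]-oo, s2val (h n)]%classic :> set R.
    apply/seteqP; split=> y /=; rewrite in_itv/=.
      move=> yx n _ /=; rewrite in_itv/=; case: (h n) => u /= /andP[xu _] _.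
      exact: le_trans yx (ltW xu).
    move=> hy; rewrite leNgt; apply/negP => xy.
    have yx0 : 0 < y - x by rewrite subr_gt0.
    pose n := Num.truncn (y - x)^-1.
    have := hy n Logic.I; rewrite /= in_itv/=.
    case: (h n) => u /= /andP[_ ux] _ yu.
    have : (y - x)^-1 < n.+1%:R by exact: truncnS_gt.
    rewrite -[ltRHS]invrK ltf_pV2 ?posrE ?invr_gt0 ?ltr0n// => hn.
    move: (le_lt_trans yu ux); rewrite -ltrBlDl => /lt_trans/(_ hn).
    by rewrite ltxx.
  have [s0 sC sU] := smallest_sigma_algebra setT G.
  rewrite -[X in <<s G >> X]setCK setC_bigcap -setTD; apply: (sC).
  apply: (sU) => n; rewrite -setTD; apply: (sC); apply: sub_sigma_algebra => /=.
  by exists (s2val (h n)) => //; case: (h n).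
apply: (@g_sigma_algebra_measure_unique _ R TR G _ (fun n => `]-oo, n%:R]%classic)).
- by move=> _ [u _ ->]; exact: measurable_itv.
- by move=> n; exists n%:R.
- rewrite -subTset => x _; exists (Num.truncn `|x|).+1 => //=; rewrite in_itv/=.
  by rewrite ltW// (le_lt_trans (ler_norm x))// truncnS_gt.
- move=> _ _ [u gu ->] [v gv ->]; exists (Num.min u v).
    by rewrite /good; case: (leP u v).
  by apply/seteqP; split => x /=; rewrite !in_itv/= le_min => /andP.
- by move=> _ [u gu ->].
- by move=> n; rewrite (le_lt_trans (probability_le1 _ _))// ltry.
have mA' : (@RGenOInfty.G R).-sigma.-measurable A by rewrite -RGenOInfty.measurableE.
move: A mA' {mA}; apply: smallest_sub; first exact: smallest_sigma_algebra.
move=> _ [x ->]; rewrite -setCitvl.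
have [s0 sC sU] := smallest_sigma_algebra setT G.
by rewrite -setTD; apply: (sC); exact: ray.
Qed.

(** For a measure carried by [-1, 0] the interval [u, u + 1] with u <= -1 has the mass
of the ray that ends at u + 1. *)
Lemma eq_prob_of_unit_intervals k l :
  k (~` `[-1, 0]%classic) = 0%E -> l (~` `[-1, 0]%classic) = 0%E ->
  (forall a b : R, a < b -> exists u : R, a < u < b /\
    k `[u, u + 1]%classic = l `[u, u + 1]%classic) ->
  forall A, measurable A -> k A = l A.
Proof.
move=> k0 l0 unit_eq.
have null (m : probability TR R) (B : set TR) : m (~` `[-1, 0]%classic) = 0%E ->
    measurable B -> B `<=` ~` `[-1, 0]%classic -> m B = 0%E.
  by move=> m0 mB BC; apply: subset_measure0 m0 => //; apply: measurableC.
have one (m : probability TR R) (u : R) : m (~` `[-1, 0]%classic) = 0%E ->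
    0 <= u -> m `]-oo, u]%classic = 1%E.
  move=> m0 u0; rewrite -[RHS](@probability_setT _ _ _ m) -(setUv `]-oo, u]%classic).
  rewrite measureU//; last 2 first.
  - by apply: measurableC.
  - by rewrite setICr.
  rewrite [X in (_ + X)%E](null m _ m0) ?adde0//; first exact: measurableC.
  by apply: subsetC => x /=; rewrite !in_itv/= => /andP[_ /le_trans->].
have zero (m : probability TR R) (u : R) : m (~` `[-1, 0]%classic) = 0%E ->
    u < -1 -> m `]-oo, u]%classic = 0%E.
  move=> m0 u0; apply: (null m _ m0) => // x /=; rewrite !in_itv/= => xu /andP[x1 _].
  by have := lt_le_trans (le_lt_trans xu u0) x1; rewrite ltxx.
apply: eq_prob_of_dense_cdf => [x y xy|n]; last by rewrite !one.
have [x1|x1] := ltP x (-1).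
  have m1 : x < Num.min y (-1) by rewrite lt_min xy.
  have m2 : Num.min y (-1) <= y by rewrite ge_min lexx.
  have m3 : Num.min y (-1) <= -1 by rewrite ge_min lexx orbT.
  exists ((x + Num.min y (-1)) / 2); first by apply/andP; split; lra.
  by rewrite !zero//; lra.
have [x0|x0] := leP 0 x.
  by exists ((x + y) / 2); [by apply/andP; split; lra|rewrite !one//; lra].
have m1 : x < Num.min y 0 by rewrite lt_min xy.
have m2 : Num.min y 0 <= y by rewrite ge_min lexx.
have m3 : Num.min y 0 <= 0 by rewrite ge_min lexx orbT.
have [|u [/andP[u1 u2] equ]] := unit_eq (x - 1) (Num.min y 0 - 1); first lra.
exists (u + 1); first by apply/andP; split; lra.
have split_ray (m : probability TR R) : m (~` `[-1, 0]%classic) = 0%E ->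
    m `]-oo, u + 1]%classic = m `[u, u + 1]%classic.
  move=> m0.
  have -> : `]-oo, u + 1]%classic =
      `]-oo, u[%classic `|` `[u, u + 1]%classic :> set TR.
    apply/seteqP; split=> z /=; rewrite !in_itv/=.
      by move=> zu; have [|] := ltP z u; [left|right].
    by move=> [zu|/andP[]//]; lra.
  rewrite measureU//; last first.
    apply/seteqP; split=> z //= []; rewrite !in_itv/= => zu /andP[uz _].
    by have := lt_le_trans zu uz; rewrite ltxx.
  rewrite [X in (X + _)%E](null m _ m0) ?add0e// => z /=; rewrite !in_itv/= => zu /andP[z1 _].
  by clear - u2 m3 zu z1; lra.
by rewrite !split_ray.
Qed.

(** Uniqueness principle: the hypothesis says that the energy of the signed measure
k - l is not positive. *)
Lemma eq_prob_of_energy k l :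
  k (~` `[-1, 0]%classic) = 0%E -> l (~` `[-1, 0]%classic) = 0%E ->
  (mutual k l < +oo)%E -> (mutual k k + mutual l l <= 2%:E * mutual k l)%E ->
  forall A, measurable A -> k A = l A.
Proof.
move=> k0 l0 fin le_kl; apply: eq_prob_of_unit_intervals => //.
exact: dense_unit_interval_mass_eq.
Qed.

Lemma measurable_log_ker : measurable_fun [set: R] (@log_ker R).
Proof.
apply: measurable_fun_ifT => //; first by apply: measurable_fun_eqr.
apply/measurable_EFinP; apply: measurable_maxr => //; apply: measurable_funN.
apply: (measurableT_comp (@measurable_ln R)).
exact: normr_measurable.
Qed.

Lemma measurable_log_ker_sub d d' (T : measurableType d) (T' : measurableType d')
    (f : T -> R) (g : T' -> R) : measurable_fun setT f -> measurable_fun setT g ->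
  measurable_fun [set: T * T'] (fun p => log_ker (f p.1 - g p.2)).
Proof.
move=> mf mg; apply: (measurableT_comp measurable_log_ker).
apply: measurable_funB.
  exact: (measurableT_comp mf measurable_fst).
exact: (measurableT_comp mg measurable_snd).
Qed.

Definition potential l (x : R) : \bar R := (\int[l]_y log_ker (x - y))%E.

Lemma potential_ge0 l x : (0 <= potential l x)%E.
Proof. by apply: integral_ge0 => y _; exact: log_ker_ge0. Qed.

Lemma measurable_potential l : measurable_fun [set: TR] (potential l).
Proof.
apply: (@measurable_fun_fubini_tonelli_F _ _ TR TR R l (fun p => log_ker (p.1 - p.2))).
  exact: (measurable_log_ker_sub (@measurable_id _ TR _) (@measurable_id _ TR _)).
by move=> p; exact: log_ker_ge0.
Qed.

Lemma measurable_log_ker1 (x : R) (g : TR -> R) : measurable_fun setT g ->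
  measurable_fun [set: TR] (fun y => log_ker (x - g y)).
Proof.
by move=> mg; apply: (measurableT_comp measurable_log_ker); exact: measurable_funB.
Qed.

(** The truncation in [log_ker] is inactive for |x|, |y| <= 1. *)
Lemma log_kerM (x y : R) : `|x| <= 1 -> `|y| <= 1 ->
  log_ker (x * y) = (log_ker x + log_ker y)%E.
Proof.
move=> x1 y1; rewrite /log_ker mulf_eq0.
case: (eqVneq x 0) => [_|x0] /=; first by case: (eqVneq y 0).
case: (eqVneq y 0) => [_|y0] //=.
have lnle (z : R) : `|z| <= 1 -> 0 <= - ln `|z| by move=> z1; rewrite oppr_ge0 ln_le0.
rewrite !max_r ?lnle//; last by rewrite normrM mulr_ile1.
by rewrite normrM lnM ?posrE ?normr_gt0// opprD.
Qed.

End EnergyUniqueness.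

(** * Borel structure of the complex plane *)

Section ComplexPlane.
Context {R : realType}.
Local Notation TR := (measurableTypeR R).
Local Notation TC := (borelC R).

Definition cabs (z : R[i]) : R := Num.sqrt (complex.Re z ^+ 2 + complex.Im z ^+ 2).

Lemma normc_cabs (z : R[i]) : `|z| = (cabs z)%:C.
Proof. exact: normc_def. Qed.

Lemma cabs_real (x : R) : cabs x%:C = `|x|.
Proof. by rewrite /cabs /= expr0n addr0 sqrtr_sqr. Qed.

Lemma Re_le_cabs (z : R[i]) : `|complex.Re z| <= cabs z.
Proof. by rewrite -sqrtr_sqr ler_wsqrtr// lerDl sqr_ge0. Qed.

Lemma Im_le_cabs (z : R[i]) : `|complex.Im z| <= cabs z.
Proof. by rewrite -sqrtr_sqr ler_wsqrtr// lerDr sqr_ge0. Qed.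

Lemma cabs_triangle (x y z : R[i]) : cabs (x - z) <= cabs (x - y) + cabs (y - z).
Proof.
rewrite -lecR rmorphD /= -!normc_cabs.
by rewrite (_ : x - z = (x - y) + (y - z)) ?ler_normD//; rewrite addrA subrK.
Qed.

Lemma ball_cabs (z w : R[i]) (e : R) : ball (z : (R[i])^o) e%:C w <-> cabs (z - w) < e.
Proof. by rewrite -ball_normE /ball_ /= normc_cabs ltcR. Qed.

(** The radii of balls in the plane are complex numbers that happen to be positive
reals. *)
Lemma openCP (U : set (R[i])^o) : open U <->
  forall z, U z -> exists2 e : R, 0 < e & forall w, cabs (z - w) < e -> U w.
Proof.
split=> [oU z Uz|h].
  have /nbhs_ballP[e /= e0 eU] : nbhs (z : (R[i])^o) U by exact: open_nbhs_nbhs.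
  have eE : e = (complex.Re e)%:C.
    by move: e0; rewrite ltcE => /andP[/eqP ei _]; case: (e) ei => a b /= ->.
  exists (complex.Re e); first by move: e0; rewrite ltcE => /andP[].
  by move=> w zw; apply: eU; rewrite eE; apply/ball_cabs.
rewrite openE => z Uz; have [e e0 eU] := h z Uz.
apply/nbhs_ballP; exists e%:C; first by rewrite /= ltcR.
by move=> w /ball_cabs; exact: eU.
Qed.

Lemma openC_measurable (U : set (R[i])^o) : open U -> measurable (U : set TC).
Proof. by move=> oU; exact: sub_sigma_algebra. Qed.

Lemma measurable_ballC (z : (R[i])^o) (e : R) : measurable (ball z e%:C : set TC).
Proof.
apply: openC_measurable; apply/openCP => w /ball_cabs zw.
exists (e - cabs (z - w)); first by rewrite subr_gt0.
move=> v wv; apply/ball_cabs.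
by apply: (le_lt_trans (cabs_triangle z w v)); rewrite -ltrBrDl.
Qed.

(** Preimages of open rays are open. *)
Lemma measurable_of_lipschitz (f : TC -> TR) :
  (forall z w : R[i], `|f z - f w| <= cabs (z - w)) -> measurable_fun setT f.
Proof.
move=> lip; apply: (measurability _ (RGenOInfty.measurableE R)).
move=> _ [_ [x ->] <-]; rewrite setTI; apply: openC_measurable; apply/openCP => z /=.
rewrite in_itv/= andbT => xz; exists (f z - x); first by rewrite subr_gt0.
move=> w zw; rewrite in_itv/= andbT.
by have := le_lt_trans (le_trans (ler_norm _) (lip z w)) zw; lra.
Qed.

Lemma measurable_Re : measurable_fun setT (fun z : TC => complex.Re z : TR).
Proof.
by apply: measurable_of_lipschitz => z w; rewrite (le_trans _ (Re_le_cabs _))// raddfB.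
Qed.

Lemma measurable_Im : measurable_fun setT (fun z : TC => complex.Im z : TR).
Proof.
by apply: measurable_of_lipschitz => z w; rewrite (le_trans _ (Im_le_cabs _))// raddfB.
Qed.

(** The coordinate q = Re z - 1, in which the first level of the set is [-1, 0] and
the polynomials become iterates of maps that fix 0. *)
Definition re1 (z : TC) : TR := complex.Re z - 1.

Lemma measurable_re1 : measurable_fun setT re1.
Proof. by apply: measurable_funB => //; exact: measurable_Re. Qed.

Definition emb (q : TR) : TC := (1 + q)%:C.

Lemma measurable_emb : measurable_fun setT emb.
Proof.
apply: (@measurability _ _ TR TC setT emb (open : set (set (R[i])^o)) erefl).
move=> _ [U oU <-]; rewrite setTI; apply: open_measurable.
rewrite openE => q /=; move/openCP : oU => oU Uq.
have [e e0 eU] := oU _ Uq; apply/nbhs_ballP; exists e => //= p.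
rewrite -ball_normE /= => qp; apply: eU; rewrite /emb -rmorphB /= cabs_real.
by rewrite (_ : 1 + q - (1 + p) = q - p)//; ring.
Qed.

Lemma re1_emb q : re1 (emb q) = q.
Proof. by rewrite /re1 /emb /= addrAC subrr add0r. Qed.

Definition gap (p : TC * TC) : R := cabs (p.1 - p.2).

Lemma measurable_gap : measurable_fun setT gap.
Proof.
have mD (f : R[i] -> R) : {morph f : x y / x - y} -> measurable_fun setT (f : TC -> TR) ->
    measurable_fun [set: TC * TC] (fun p => f (p.1 - p.2) ^+ 2).
  move=> fB mf; apply: measurable_funX.
  rewrite (_ : (fun _ => _) = (fun p : TC * TC => f p.1 - f p.2)); last by apply/funext => p.
  apply: measurable_funB; first exact: (measurableT_comp mf measurable_fst).
  exact: (measurableT_comp mf measurable_snd).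
apply: (measurableT_comp (f := @Num.sqrt R)).
  by apply: continuous_measurable_fun; exact: sqrt_continuous.
apply: measurable_funD; apply: mD.
- exact: raddfB.
- exact: measurable_Re.
- exact: raddfB.
- exact: measurable_Im.
Qed.

Lemma log_kernel_gap z w : log_kernel z w =
  if gap (z, w) == 0 then +oo%E else (- ln (gap (z, w)))%:E.
Proof.
rewrite /log_kernel (_ : complex.Re `|z - w| = gap (z, w)); last by rewrite normc_cabs.
rewrite /gap [(z, w).1]/= [(z, w).2]/=.
have -> : (cabs (z - w) == 0) = (z == w); last by [].
by rewrite -[RHS]subr_eq0 -[RHS]normr_eq0 normc_cabs; exact/esym/(inj_eq (@complexI R)).
Qed.

Lemma measurable_log_kernel : measurable_fun setT (fun p : TC * TC => log_kernel p.1 p.2).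
Proof.
rewrite (_ : (fun _ => _) =
    fun p => if gap p == 0 then +oo%E else (- ln (gap p))%:E); last first.
  by apply/funext => -[z w]; rewrite log_kernel_gap.
apply: measurable_fun_ifT => //.
  by apply: measurable_fun_eqr => //; exact: measurable_gap.
apply/measurable_EFinP; apply: measurable_funN.
exact: (measurableT_comp (@measurable_ln R) measurable_gap).
Qed.

(** The kernel takes negative values far from the diagonal, so Tonelli is applied to
its positive and negative parts. *)
Lemma measurable_log_potential (mu : probability TC R) :
  measurable_fun [set: TC] (log_potential mu).
Proof.
rewrite (_ : log_potential mu = fun z =>
    (\int[mu]_w (fun p : TC * TC => log_kernel p.1 p.2)^\+ (z, w) -
     \int[mu]_w (fun p : TC * TC => log_kernel p.1 p.2)^\- (z, w))%E); last first.
  by apply/funext => z; rewrite /log_potential integralE; congr (_ - _)%E;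
    apply: eq_integral => w _; rewrite ?funeposE ?funenegE.
apply: emeasurable_funB; apply: measurable_fun_fubini_tonelli_F.
- by apply: measurable_funepos; exact: measurable_log_kernel.
- by move=> p; exact: funepos_ge0.
- by apply: measurable_funeneg; exact: measurable_log_kernel.
- by move=> p; exact: funeneg_ge0.
Qed.

Lemma re1_cabs (z w : R[i]) : `|re1 z - re1 w| <= cabs (z - w).
Proof.
rewrite (le_trans _ (Re_le_cabs _))//.
by rewrite [complex.Re (z - w)]raddfB /re1 opprB addrA subrK.
Qed.

Lemma cabs_sym (x y : R[i]) : cabs (x - y) = cabs (y - x).
Proof. by apply: complexI; rewrite -!normc_cabs distrC. Qed.

End ComplexPlane.

(** * Quadratic maps, words and cells *)

Section CantorSet.
Context {R : realType} (gamma : nat -> R).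
Local Notation TR := (measurableTypeR R).
Local Notation TC := (borelC R).
Local Notation r := (cantor_r gamma).
Local Notation delta := (cantor_delta gamma).
Local Notation h := (cantor_h gamma).
Local Notation K := (cantor_set gamma).
Hypothesis gamma_bound : forall s, (1 <= s)%N -> 0 < gamma s <= 1 / 32.

(** P_{2^(s+1)} = step s (P_{2^s}). *)
Definition step (s : nat) (q : R) : R := q * (q + r s).

(** With the convention P_1 = x - 1 = q, [orbit 0 s] is P_{2^s}. *)
Fixpoint orbit (s n : nat) (q : R) : R :=
  if n is n'.+1 then step (s + n') (orbit s n' q) else q.

(** For s = 0 this is the Cantor set itself in the coordinate q, and in general it is
the image of that set under P_{2^s}. *)
Definition level_set (s : nat) : set R :=
  [set q | forall n, - r (s + n) <= orbit s n q <= 0].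

(** The two solutions of step s p = q, the larger one for b = true. *)
Definition branch (s : nat) (b : bool) (q : R) : R :=
  (- r s + (-1) ^+ (~~ b) * Num.sqrt (r s ^+ 2 + 4 * q)) / 2.

Definition bit (s : nat) (q : R) : bool := - r s / 2 < orbit 0 s q.

(** The most recent bit comes first, so that the parent of a cell is given by the
tail of its word. *)
Fixpoint word (s : nat) (q : R) : seq bool :=
  if s is s'.+1 then bit s' q :: word s' q else [::].

Lemma size_word s q : size (word s q) = s.
Proof. by elim: s => //= s ->. Qed.

Lemma horner_cantor_poly s x : (cantor_poly gamma s).[x] = orbit 0 s.+1 (x - 1).
Proof.
elim: s => [|s IH].
  by rewrite /= /step /= !hornerE; ring.
by rewrite [cantor_poly _ _]/= hornerM hornerD hornerC IH.
Qed.

Lemma orbit_front s n q : orbit s n.+1 q = orbit s.+1 n (step s q).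
Proof.
elim: n q => [q|n IH q]; first by rewrite /= addn0.
have -> : orbit s n.+2 q = step (s + n.+1) (orbit s n.+1 q) by [].
by rewrite IH /= addSnnS.
Qed.

Lemma gammaS_gt0 s : 0 < gamma s.+1.
Proof. by have /andP[] := gamma_bound (ltn0Sn s). Qed.

Lemma gammaS_le s : gamma s.+1 <= 1 / 32.
Proof. by have /andP[] := gamma_bound (ltn0Sn s). Qed.

Lemma r_gt0 s : 0 < r s.
Proof.
elim: s => [|s IH]; first exact: ltr01.
by rewrite /= mulr_gt0 ?gammaS_gt0 ?exprn_gt0.
Qed.

Lemma cantor_rS s : r s.+1 = gamma s.+1 * r s ^+ 2. Proof. by []. Qed.

Lemma deltaS s : delta s.+1 = delta s * gamma s.+1.
Proof. by rewrite /cantor_delta big_nat_recr. Qed.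

Lemma delta0 : delta 0 = 1.
Proof. by rewrite /cantor_delta big_geq. Qed.

Lemma delta_gt0 s : 0 < delta s.
Proof.
elim: s => [|s IH]; first by rewrite delta0.
by rewrite deltaS mulr_gt0 ?gammaS_gt0.
Qed.

Lemma deltaS_le s : delta s.+1 <= delta s / 32.
Proof.
by rewrite deltaS ler_wpM2l ?(ltW (delta_gt0 _))// (le_trans (gammaS_le s))// mul1r.
Qed.

Lemma deltaD_le s m : delta (s + m) <= delta s / 32 ^+ m.
Proof.
elim: m => [|m IH]; first by rewrite addn0 expr0 divr1.
rewrite addnS (le_trans (deltaS_le _))// exprS invfM mulrA mulrAC.
by rewrite ler_pM2r ?invr_gt0.
Qed.

Lemma deltaS_lt s : delta s.+1 < delta s.
Proof.
apply: le_lt_trans (deltaS_le s) _.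
by have := delta_gt0 s; lra.
Qed.

Lemma delta_anti s t : (s <= t)%N -> delta t <= delta s.
Proof.
move=> st; rewrite -(subnKC st); elim: (t - s)%N => [|m IH]; first by rewrite addn0.
by rewrite addnS (le_trans (ltW (deltaS_lt _))).
Qed.

Lemma delta_small (e : R) : 0 < e -> exists n, delta n < e.
Proof.
move=> e0; exists (Num.truncn e^-1).+1; set n := _.+1.
have := deltaD_le 0 n; rewrite add0n delta0 div1r => /le_lt_trans; apply.
rewrite -[ltRHS]invrK ltf_pV2 ?posrE ?invr_gt0 ?exprn_gt0//.
apply: (@lt_trans _ _ n%:R); first exact: truncnS_gt.
by rewrite -natrX ltr_nat ltn_expl.
Qed.

(** This identity is what makes the lengths of cells comparable to delta: the
derivative of P_{2^s} has the order of the product of the r_k with k < s, while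
its oscillation on a cell is r_s. *)
Lemma r_delta s : r s = delta s * \prod_(k < s) r k.
Proof.
elim: s => [|s IH]; first by rewrite big_ord0 mulr1 delta0.
rewrite cantor_rS big_ord_recr /= deltaS expr2 {1}IH; ring.
Qed.

Lemma prod_r_gt0 s : 0 < \prod_(k < s) r k.
Proof. by apply: prodr_gt0 => i _; exact: r_gt0. Qed.

(** step s p - step s q = (p - q) (p + q + r_s), iterated. *)
Lemma orbit_diff s q p : orbit 0 s q - orbit 0 s p =
  (q - p) * \prod_(k < s) (orbit 0 k q + orbit 0 k p + r k).
Proof.
elim: s => [|s IH]; first by rewrite big_ord0 mulr1.
by rewrite big_ord_recr /= mulrA -IH /step add0n; ring.
Qed.

(** That the orbit enters [- r_(s+1), 0] at level s + 1 forces it to lie in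
[- r_s, 0] at level s, since q (q + r_s) <= 0 there only. *)
Lemma level_set_step s q : level_set s q <-> level_set s.+1 (step s q).
Proof.
split=> [Kq n|Kq [|n]].
- by have := Kq n.+1; rewrite orbit_front addSnnS.
- rewrite addn0 /=.
  have := Kq 0%N; rewrite addn0 /= /step => /andP[_ h0].
  have rs := r_gt0 s; apply/andP; split.
    by rewrite leNgt; apply/negP => h; nra.
  by rewrite leNgt; apply/negP => h; nra.
- by rewrite orbit_front -addSnnS; exact: Kq.
Qed.

Lemma level_setB s q : level_set s q -> - r s <= q <= 0.
Proof. by move=> /(_ 0%N); rewrite addn0. Qed.

Lemma level_set_orbit s q : level_set 0 q -> level_set s (orbit 0 s q).
Proof.
by move=> Kq; elim: s => //= s /level_set_step.
Qed.

Lemma sqr_critical s q : (2 * q + r s) ^+ 2 = r s ^+ 2 + 4 * step s q.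
Proof. by rewrite /step; ring. Qed.

(** By [sqr_critical] the distance to the critical point is controlled by the next
level: (2 q + r_s)^2 >= r_s^2 (1 - 4 gamma), and 1 - 4 gamma >= (1 - 4 gamma)^2
avoids a square root. *)
Lemma critical_ge s q : level_set s q -> r s * (1 - 4 * gamma s.+1) <= `|2 * q + r s|.
Proof.
move=> /level_set_step/level_setB/andP[+ _]; rewrite cantor_rS => h.
have g0 := gammaS_gt0 s; have g1 := gammaS_le s; have rs := r_gt0 s.
rewrite -(@ler_pXn2r _ 2)// ?nnegrE ?normr_ge0 ?mulr_ge0 ?(ltW rs)//; last by lra.
rewrite real_normK ?num_real// sqr_critical exprMn.
have : 0 <= r s ^+ 2 by rewrite sqr_ge0.
set t := r s ^+ 2 in h *; set g := gamma s.+1 in h g0 g1 *; set u := step s q in h *.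
move=> t0; have : 0 <= t * g * (1 - 4 * g) by rewrite !mulr_ge0 ?(ltW g0)//; lra.
by rewrite expr2; nra.
Qed.

Lemma critical_le s q : level_set s q -> `|2 * q + r s| <= r s.
Proof. by move=> /level_setB/andP[h1 h2]; rewrite ler_norml; apply/andP; split; lra. Qed.

Lemma bitP s q : bit s q = (0 < 2 * orbit 0 s q + r s).
Proof. by rewrite /bit; apply/idP/idP => h; lra. Qed.

(** With equal bits 2 p + r_s and 2 q + r_s have the same sign, and the absolute value
of their mean is the mean of their absolute values. *)
Lemma same_bit_sum s q p : level_set 0 q -> level_set 0 p ->
  bit s q = bit s p ->
  r s * (1 - 4 * gamma s.+1) <= `|orbit 0 s q + orbit 0 s p + r s| <= r s.
Proof.
move=> Kq Kp; rewrite !bitP.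
move/(@level_set_orbit s) : Kq => Kq; move/(@level_set_orbit s) : Kp => Kp.
have := critical_ge Kq; have := critical_ge Kp.
have := critical_le Kq; have := critical_le Kp.
set a := orbit 0 s q; set b := orbit 0 s p => h1 h2 h3 h4 hab.
have -> : a + b + r s = ((2 * a + r s) + (2 * b + r s)) / 2 by lra.
move: h1 h2 h3 h4 hab; set u := 2 * a + r s; set v := 2 * b + r s.
have [u0|u0] := ltP 0 u; have [v0|v0] := ltP 0 v => // + + + + _.
  rewrite (gtr0_norm u0) (gtr0_norm v0) gtr0_norm; last by lra.
  by move=> h1 h2 h3 h4; apply/andP; split; lra.
rewrite (ler0_norm u0) (ler0_norm v0) ler0_norm; last by lra.
by move=> h1 h2 h3 h4; apply/andP; split; lra.
Qed.

(** With different bits they have opposite signs, and their difference adds up. *)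
Lemma diff_bit_sub s q p : level_set 0 q -> level_set 0 p ->
  bit s q != bit s p ->
  r s * (1 - 4 * gamma s.+1) <= `|orbit 0 s q - orbit 0 s p|.
Proof.
move=> Kq Kp; rewrite !bitP.
move/(@level_set_orbit s) : Kq => Kq; move/(@level_set_orbit s) : Kp => Kp.
have := critical_ge Kq; have := critical_ge Kp.
set a := orbit 0 s q; set b := orbit 0 s p => h1 h2 hab.
have -> : a - b = ((2 * a + r s) - (2 * b + r s)) / 2 by lra.
move: h1 h2 hab; set u := 2 * a + r s; set v := 2 * b + r s.
have [u0|u0] := ltP 0 u; have [v0|v0] := ltP 0 v => // + + _.
  by rewrite (gtr0_norm u0) (ler0_norm v0) gtr0_norm; lra.
by rewrite (ler0_norm u0) (gtr0_norm v0) ler0_norm; lra.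
Qed.

Lemma wordS_eq s q p : word s.+1 q = word s.+1 p <->
  bit s q = bit s p /\ word s q = word s p.
Proof. by split=> [[-> ->]|[/= -> ->]]. Qed.

Lemma word_bit s k q p : (k < s)%N -> word s q = word s p -> bit k q = bit k p.
Proof.
elim: s => // s IH; rewrite ltnS leq_eqVlt => /orP[/eqP->|ks] /wordS_eq[]//.
by move=> _; exact: IH.
Qed.

Lemma orbit_le0 s q : level_set 0 q -> - r s <= orbit 0 s q <= 0.
Proof. by move=> Kq; exact: level_setB (level_set_orbit s Kq). Qed.

(** P_{2^s} varies by r_s at most, and [orbit_diff] bounds its slope from below. *)
Lemma cell_diam s q p : level_set 0 q -> level_set 0 p -> word s q = word s p ->
  `|q - p| * \prod_(k < s) (1 - 4 * gamma k.+1) <= delta s.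
Proof.
move=> Kq Kp qp; have R0 := prod_r_gt0 s.
rewrite -(ler_pM2r R0) -r_delta -mulrA [X in _ * X]mulrC -big_split /=.
apply: (@le_trans _ _ `|orbit 0 s q - orbit 0 s p|).
  rewrite orbit_diff normrM normr_prod ler_wpM2l ?normr_ge0//.
  apply: ler_prod => k _; apply/andP; split.
    by rewrite mulr_ge0 ?(ltW (r_gt0 _))//; have := gammaS_le k; lra.
  by have /andP[] := same_bit_sum Kq Kp (word_bit (ltn_ord k) qp).
have /andP[h1 h2] := orbit_le0 s Kq; have /andP[h3 h4] := orbit_le0 s Kp.
by rewrite ler_norml; apply/andP; split; lra.
Qed.

(** At the first level k < s where the words differ the images under P_{2^k} are
nearly r_k apart, while [orbit_diff] bounds the slope from above; this gives about
delta_k, and delta_s <= delta_k / 32. *)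
Lemma cell_gap s q p : level_set 0 q -> level_set 0 p -> word s q <> word s p ->
  16 * delta s <= `|q - p|.
Proof.
move=> Kq Kp; elim: s => // s IH qp.
have [wqp|wqp] := eqVneq (word s q) (word s p); last first.
  by rewrite (le_trans _ (IH (elimN eqP wqp)))// ler_pM2l// (ltW (deltaS_lt _)).
have bqp : bit s q != bit s p.
  by apply/eqP => bqp; apply: qp; apply/wordS_eq.
have R0 := prod_r_gt0 s.
rewrite -(ler_pM2r R0); apply: (@le_trans _ _ `|orbit 0 s q - orbit 0 s p|).
  rewrite (le_trans _ (diff_bit_sub Kq Kp bqp))// [in X in _ <= X]r_delta.
  have := deltaS_le s; have := delta_gt0 s; have := gammaS_le s.
  move=> h1 h2 h3; rewrite [leRHS]mulrAC ler_pM2r//; nra.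
rewrite orbit_diff normrM normr_prod ler_wpM2l ?normr_ge0//.
apply: ler_prod => k _; rewrite normr_ge0/=.
by have /andP[] := same_bit_sum Kq Kp (word_bit (ltn_ord k) wqp).
Qed.

Lemma step_branch s b q : - r s ^+ 2 / 4 <= q -> step s (branch s b q) = q.
Proof.
move=> q0; rewrite /step /branch.
set e := (-1) ^+ _; set t := Num.sqrt _.
have t2 : t ^+ 2 = r s ^+ 2 + 4 * q by rewrite sqr_sqrtr; lra.
have e2 : e ^+ 2 = 1 by rewrite sqrr_sign.
have -> : (- r s + e * t) / 2 * ((- r s + e * t) / 2 + r s) =
  (e ^+ 2 * t ^+ 2 - r s ^+ 2) / 4 by field.
by rewrite e2 t2; lra.
Qed.

Lemma branch_gt s b q : - r s ^+ 2 / 4 < q -> (- r s / 2 < branch s b q) = b.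
Proof.
move=> q0; rewrite /branch.
have : 0 < Num.sqrt (r s ^+ 2 + 4 * q) by rewrite sqrtr_gt0; lra.
set t := Num.sqrt _ => t0.
case: b; rewrite /= ?expr0 ?expr1 ?mul1r ?mulN1r.
  by rewrite ltr_pM2r ?invr_gt0// ltrDl.
by apply/negbTE; rewrite -leNgt ler_pM2r ?invr_gt0// gerDl oppr_le0 ltW.
Qed.

Lemma level_set_gt s q : level_set s.+1 q -> - r s ^+ 2 / 4 < q.
Proof.
move=> /level_setB/andP[+ _]; rewrite cantor_rS => h; apply: lt_le_trans h.
have g := gammaS_le s.
have t0 : 0 < r s ^+ 2 by rewrite exprn_gt0// r_gt0.
by nra.
Qed.

Lemma level_set_branch s b q : level_set s.+1 q -> level_set s (branch s b q).
Proof.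
move=> Kq; apply/level_set_step => //.
by rewrite step_branch// ltW// level_set_gt.
Qed.

Lemma one_sub_ge_expR (x : R) : 0 <= x <= 1 / 2 -> expR (- (2 * x)) <= 1 - x.
Proof.
move=> /andP[x0 x1]; rewrite expRN -div1r ler_pdivrMr ?expR_gt0//.
have := expR_ge1Dx (2 * x); nra.
Qed.

Hypothesis gamma_summable : (\sum_(1 <= s <oo) (gamma s)%:E < +oo)%E.

(** The product of the 1 - 4 gamma_k is at least exp (- 8 sum gamma_k) > 0, and delta
decreases by a factor 32 at least per level, so m levels absorb the constant. *)
Lemma cell_diam_uniform : exists m : nat, forall s q p,
  level_set 0 q -> level_set 0 p -> word (s + m) q = word (s + m) p ->
  `|q - p| < delta s.
Proof.
have [G Gle] : exists G : R, forall s, \sum_(1 <= k < s.+1) gamma k <= G.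
  pose S := (\sum_(1 <= s <oo) (gamma s)%:E)%E.
  have S0 : (0 <= S)%E.
    apply: nneseries_ge0 => n n1 _; rewrite lee_fin ltW//.
    by have /andP[] := gamma_bound n1.
  exists (fine S) => s; rewrite -lee_fin fineK ?ge0_fin_numE// -sumEFin.
  apply: nneseries_lim_ge => n n1 _; rewrite lee_fin ltW//.
  by have /andP[] := gamma_bound n1.
(* 1 - x >= exp (- 2 x) with x = 4 gamma *)
pose c := expR (- (8 * G)).
have cle s : c <= \prod_(k < s) (1 - 4 * gamma k.+1).
  apply: (@le_trans _ _ (\prod_(k < s) expR (- (2 * (4 * gamma k.+1))))).
    rewrite -expR_sum /c ler_expR sumrN lerN2.
    have := Gle s; rewrite big_add1 /= big_mkord => /(ler_wpM2l (ler0n _ 8)).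
    by rewrite mulr_sumr; under [in X in X -> _]eq_bigr => i _ do rewrite (natrM _ 2 4) -mulrA.
  apply: ler_prod => k _; rewrite expR_ge0 one_sub_ge_expR//.
  have := gammaS_gt0 k; have := gammaS_le k => h1 h2.
  by apply/andP; split; lra.
have c0 : 0 < c by exact: expR_gt0.
have [m hm] : exists m, 1 < c * 32 ^+ m.
  have [m] : exists m : nat, c^-1 < m%:R.
    by exists (Num.truncn c^-1).+1; exact: truncnS_gt.
  move=> hm; exists m; rewrite mulrC -ltr_pdivrMr// div1r (lt_le_trans hm)//.
  by rewrite -natrX ler_nat ltnW// ltn_expl.
exists m => s q p Kq Kp qp.
have := cell_diam Kq Kp qp.
have := cle (s + m)%N; have := deltaD_le s m; have := delta_gt0 s.
set d := delta s; set P := \prod_(_ < _) _; set x := `|_| => d0 h1 h2 h3.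
have x0 : 0 <= x by exact: normr_ge0.
have m0 : 0 < 32 ^+ m :> R by rewrite exprn_gt0.
have h4 : x * c <= d / 32 ^+ m.
  by rewrite (le_trans _ (le_trans h3 h1))// ler_wpM2l.
move: h4; rewrite ler_pdivlMr// -mulrA => h4.
have [->//|xn0] := eqVneq x 0.
have xp : 0 < x by rewrite lt_def xn0.
by apply: lt_le_trans h4; rewrite ltr_pMr.
Qed.

(** * Averaging over inverse branches *)

Implicit Types k l : probability TR R.

Lemma r_le1 s : r s <= 1.
Proof.
elim: s => [|s IH] //=; have g0 := gammaS_gt0 s.
have g1 := gammaS_le s; have r0 := r_gt0 s.
have t1 : r s ^+ 2 <= 1 by rewrite exprn_ile1// ltW.
have t0 : 0 < r s ^+ 2 by rewrite exprn_gt0.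
by nra.
Qed.

Lemma measurable_step s : measurable_fun [set: TR] (step s : TR -> TR).
Proof. by apply: measurable_funM => //; exact: measurable_funD. Qed.

Lemma measurable_orbit s n : measurable_fun [set: TR] (orbit s n : TR -> TR).
Proof.
elim: n => [|n IH] //=.
exact: (measurableT_comp (measurable_step (s + n)) IH).
Qed.

Lemma measurable_branch s b : measurable_fun [set: TR] (branch s b : TR -> TR).
Proof.
apply: measurable_funM => //; apply: measurable_funD => //.
apply: measurable_funM => //.
apply: (measurableT_comp (f := @Num.sqrt R)).
  by apply: continuous_measurable_fun; exact: sqrt_continuous.
by apply: measurable_funD => //; apply: measurable_funM.
Qed.

Lemma measurable_level_set s : measurable (level_set s : set TR).
Proof.
have -> : level_set s = \bigcap_n (orbit s n @^-1` `[- r (s + n), 0]%classic).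
  apply/seteqP; split=> q h n; first by move=> _ /=; rewrite in_itv/=; exact: h.
  by have := h n Logic.I; rewrite /= in_itv.
apply: bigcapT_measurable => n; rewrite -[X in measurable X]setTI.
exact: measurable_orbit.
Qed.

Lemma measurable_level_setC s : measurable (~` level_set s : set TR).
Proof. by apply: measurableC; exact: measurable_level_set. Qed.

(** step s a - step s b = (a - b) (a + b + r_s), so the energy of the image is the
energy of k plus the mutual energy of k and its reflection about - r_s / 2.  The
latter has the same energy as k, and [mutual_le] applies. *)
Lemma mutual_step_le s k k' : k (~` level_set s) = 0%E ->
  (forall A, measurable A -> k' A = k (step s @^-1` A)) ->
  (mutual k' k' <= 2%:E * mutual k k)%E.
Proof.
move=> k0 k'E; have mS := measurable_level_set s; have ms := measurable_step s.
(* the reflection about - r_s / 2 exchanges the two preimages under the step *)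
pose refl (q : TR) : TR := - r s - q.
have mrefl : measurable_fun [set: TR] refl by exact: measurable_funB.
have [m mE] := pushforward_exists k mrefl.
have pot1 x : level_set s x -> potential k' (step s x) = (potential k x + potential m x)%E.
  move=> Sx; rewrite /potential.
  rewrite (ge0_integral_law ms k'E); last 2 first.
  - by apply: measurable_log_ker1.
  - by move=> y; exact: log_ker_ge0.
  rewrite (ge0_integral_law mrefl (fun A _ => mE A)); last 2 first.
  - by apply: measurable_log_ker1.
  - by move=> y; exact: log_ker_ge0.
  rewrite -ge0_integralD//; last 4 first.
  - by move=> y _; exact: log_ker_ge0.
  - by apply: measurable_log_ker1.
  - by move=> y _; exact: log_ker_ge0.
  - by apply: measurable_log_ker1.
  apply: (ge0_eq_integral_supp mS k0).
  - by apply: measurable_log_ker1.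
  - by apply: emeasurable_funD; apply: measurable_log_ker1.
  - by move=> y; exact: log_ker_ge0.
  - by move=> y; rewrite adde_ge0// log_ker_ge0.
  move=> y Sy; rewrite -log_kerM.
  - by congr log_ker; rewrite /step /refl; ring.
  - have := r_le1 s; have /andP[] := level_setB Sx; have /andP[] := level_setB Sy => *.
    by rewrite ler_norml; apply/andP; split; lra.
  - have := r_le1 s; have /andP[] := level_setB Sx; have /andP[] := level_setB Sy => *.
    by rewrite /refl ler_norml; apply/andP; split; lra.
have mutE : mutual k' k' = (mutual k k + mutual k m)%E.
  rewrite {1}/mutual -/(potential k' _).
  rewrite (ge0_integral_law ms k'E (measurable_potential k') (potential_ge0 k')).
  rewrite -ge0_integralD//; last 4 first.
  - by move=> x _; exact: potential_ge0.
  - exact: measurable_potential.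
  - by move=> x _; exact: potential_ge0.
  - exact: measurable_potential.
  apply: (ge0_eq_integral_supp mS k0) => //.
  - exact: (measurableT_comp (measurable_potential k') ms).
  - by apply: emeasurable_funD; exact: measurable_potential.
  - by move=> x; exact: potential_ge0.
  - by move=> x; rewrite adde_ge0// potential_ge0.
have mm : mutual m m = mutual k k.
  rewrite {1}/mutual (ge0_integral_law mrefl (fun A _ => mE A)
    (measurable_potential m) (potential_ge0 m)).
  apply: eq_integral => x _; rewrite /potential.
  rewrite (ge0_integral_law mrefl (fun A _ => mE A)); last 2 first.
  - by apply: measurable_log_ker1.
  - by move=> y; exact: log_ker_ge0.
  apply: eq_integral => y _; rewrite -log_kerN; congr log_ker; rewrite /refl; ring.
rewrite mutE mule_natl mule2n leeD2l//.
have := mutual_le k m; rewrite mm => h.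
by rewrite -(@lee_pmul2l _ 2%:E)// [leRHS]mule_natl mule2n.
Qed.

(** A relation between l and l', because images and averages of probabilities are
provided by existence lemmas. *)
Definition branch_average s l l' := exists m0 m1 : probability TR R,
  [/\ forall A, m0 A = l (branch s false @^-1` A),
      forall A, m1 A = l (branch s true @^-1` A) &
      forall A, l' A = ((2^-1)%R%:E * (m0 A + m1 A))%E].

Lemma branch_average_exists s l : exists l', branch_average s l l'.
Proof.
have [m0 m0E] := pushforward_exists l (measurable_branch s false).
have [m1 m1E] := pushforward_exists l (measurable_branch s true).
by have [l' l'E] := average_exists m0 m1; exists l', m0, m1.
Qed.

Lemma branch_averageE s l l' A : branch_average s l l' ->
  l' A = ((2^-1)%R%:E * (l (branch s false @^-1` A) + l (branch s true @^-1` A)))%E.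
Proof. by move=> [m0 [m1 [m0E m1E ->]]]; rewrite m0E m1E. Qed.

Lemma branch_average_integral s l l' (g : TR -> \bar R) : branch_average s l l' ->
  measurable_fun setT g -> (forall y, 0 <= g y)%E ->
  (\int[l']_y g y = (2^-1)%R%:E * \int[l]_y (g (branch s false y) + g (branch s true y)))%E.
Proof.
move=> [m0 [m1 [m0E m1E l'E]]] mg g0.
rewrite (ge0_integral_average (fun A _ => l'E A) mg g0); congr (_ * _)%E.
have mg' b : measurable_fun setT (g \o branch s b).
  exact: (measurableT_comp mg (measurable_branch s b)).
rewrite ge0_integralD//; [|exact: (mg' false)|exact: (mg' true)].
by congr (_ + _)%E; apply: ge0_integral_law => //; exact: measurable_branch.
Qed.

Lemma branch_average_supp s l l' : branch_average s l l' ->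
  l (~` level_set s.+1) = 0%E -> l' (~` level_set s) = 0%E.
Proof.
move=> /branch_averageE -> l0.
have z b : l (branch s b @^-1` (~` level_set s)) = 0%E.
  apply: subset_measure0 l0.
  - rewrite -[X in measurable X]setTI; apply: measurable_branch => //.
    exact: measurable_level_setC.
  - exact: measurable_level_setC.
  - by move=> q /= nS S; apply: nS; exact: level_set_branch.
by rewrite !z adde0 mule0.
Qed.

(** (x - y0) (x - y1) = step s x - y when y0 and y1 are the two preimages of y, so the
logarithms add up to the potential of l at step s x. *)
Lemma branch_average_potential s l l' x : branch_average s l l' ->
  l (~` level_set s.+1) = 0%E -> level_set s x ->
  potential l' x = ((2^-1)%R%:E * potential l (step s x))%E.
Proof.
move=> avg l0 Sx; rewrite /potential (branch_average_integral avg); last 2 first.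
- by apply: measurable_log_ker1.
- by move=> y; exact: log_ker_ge0.
congr (_ * _)%E; have mlk b := measurable_log_ker1 x (measurable_branch s b).
apply: (ge0_eq_integral_supp (measurable_level_set s.+1) l0).
- by apply: emeasurable_funD; exact: mlk.
- by apply: measurable_log_ker1.
- by move=> y; rewrite adde_ge0// log_ker_ge0.
- by move=> y; exact: log_ker_ge0.
move=> y Sy; rewrite -log_kerM; last 2 first.
- have := r_le1 s; have /andP[] := level_setB Sx.
  have /andP[] := level_setB (level_set_branch false Sy) => *.
  by rewrite ler_norml; apply/andP; split; lra.
- have := r_le1 s; have /andP[] := level_setB Sx.
  have /andP[] := level_setB (level_set_branch true Sy) => *.
  by rewrite ler_norml; apply/andP; split; lra.
congr log_ker; have ly := level_set_gt Sy.
have s0 := step_branch false (ltW ly).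
transitivity (step s x - step s (branch s false y)); last by rewrite s0.
by rewrite /step /branch /= expr0 expr1; field.
Qed.

(** Hence averaging on one side amounts to pushing the other side forward. *)
Lemma branch_average_mutual s k k' l l' : branch_average s l l' ->
  l (~` level_set s.+1) = 0%E -> k (~` level_set s) = 0%E ->
  (forall A, measurable A -> k' A = k (step s @^-1` A)) ->
  mutual k l' = ((2^-1)%R%:E * mutual k' l)%E.
Proof.
move=> avg l0 k0 k'E.
rewrite {2}/mutual (ge0_integral_law (measurable_step s) k'E
  (measurable_potential l) (potential_ge0 l)).
rewrite -ge0_integralZl//; last 2 first.
- exact: (measurableT_comp (measurable_potential l) (measurable_step s)).
- by move=> x _; exact: potential_ge0.
apply: (ge0_eq_integral_supp (measurable_level_set s) k0).
- exact: measurable_potential.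
- apply: emeasurable_funM => //.
  exact: (measurableT_comp (measurable_potential l) (measurable_step s)).
- by move=> x; exact: potential_ge0.
- by move=> x; rewrite mule_ge0 ?potential_ge0// lee_fin invr_ge0.
by move=> x Sx; exact: branch_average_potential.
Qed.

Lemma preimage_branch_step s b l A : l (~` level_set s.+1) = 0%E -> measurable A ->
  l (branch s b @^-1` (step s @^-1` A)) = l A.
Proof.
move=> l0 mA; apply: (eq_prob_supp (measurable_level_set s.+1) l0) => //.
  rewrite -[X in measurable X]setTI; apply: measurable_branch => //.
  by rewrite -[X in measurable X]setTI; exact: measurable_step.
by move=> q Sq /=; rewrite step_branch// ltW// (level_set_gt).
Qed.

(** The image of l' under step s is l again. *)
Lemma branch_average_energy s l l' : branch_average s l l' ->
  l (~` level_set s.+1) = 0%E -> mutual l' l' = ((2^-1)%R%:E * mutual l l)%E.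
Proof.
move=> avg l0; apply: (branch_average_mutual avg l0).
  exact: branch_average_supp avg l0.
move=> A mA; rewrite (branch_averageE _ avg) !preimage_branch_step//.
rewrite -[X in (_ = _ * (X + X))%E]fineK ?fin_num_measure// -EFinD -EFinM.
by rewrite (_ : 2^-1 * _ = fine (l A))%R ?fineK ?fin_num_measure//; field.
Qed.

(** * Equidistribution of minimizers *)

Lemma measurable_bit s : measurable [set q : TR | bit s q].
Proof.
have -> : [set q : TR | bit s q] = orbit 0 s @^-1` `]- r s / 2, +oo[%classic.
  by apply/seteqP; split=> q /=; rewrite in_itv/= andbT.
by rewrite -[X in measurable X]setTI; exact: measurable_orbit.
Qed.

(** All reals with a given word; measures carried by the Cantor set only see its trace
on that set, [cell0]. *)
Definition cell (w : seq bool) : set R := [set q | word (size w) q = w].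

Lemma cell_cons b w : cell (b :: w) = cell w `&` [set q | bit (size w) q = b].
Proof. apply/seteqP; split=> q; rewrite /cell /=; first by move=> [bq wq].
by move=> [wq bq]; rewrite wq bq. Qed.

Lemma measurable_cell w : measurable (cell w : set TR).
Proof.
elim: w => [|b w IH]; first by rewrite (_ : cell _ = setT)//; apply/seteqP; split.
rewrite cell_cons; apply: measurableI => //; case: b; first exact: measurable_bit.
rewrite (_ : [set _ | _] = ~` [set q | bit (size w) q]).
  by apply: measurableC; exact: measurable_bit.
by apply/seteqP; split => q /=; [move=> ->|move/negP/negbTE].
Qed.

(** Average over the inverse branches of the levels s - 1, ..., 0 in turn.  The last
clause is more precise than the equality of the masses of cells because the
induction splits a cell according to the position of its image at level s. *)
Lemma lift_exists s l : l (~` level_set s) = 0%E -> exists nu : probability TR R,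
  [/\ nu (~` level_set 0) = 0%E,
      mutual nu nu = ((2^-1 ^+ s)%:E * mutual l l)%E,
      forall k (ks : probability TR R), k (~` level_set 0) = 0%E ->
        (forall A, measurable A -> ks A = k (orbit 0 s @^-1` A)) ->
        mutual k nu = ((2^-1 ^+ s)%:E * mutual ks l)%E &
      forall w (B : set TR), size w = s -> measurable B ->
        nu (cell w `&` orbit 0 s @^-1` B) = ((2^-1 ^+ s)%:E * l B)%E].
Proof.
elim: s l => [|s IH] l l0.
  exists l; split=> //; rewrite ?expr0 ?mul1e//.
  - move=> k ks k0 ksE; rewrite mul1e; apply: eq_measure_integral => A mA _.
    by apply/esym/(eq_trans (ksE A mA)).
  - move=> [|//] B _ mB; rewrite mul1e; congr (l _).
    by apply/seteqP; split=> q //= [].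
have [l' avg] := branch_average_exists s l.
have l'0 := branch_average_supp avg l0.
have [nu [nu0 nuE nuM nuC]] := IH _ l'0; exists nu; split=> //.
- by rewrite nuE (branch_average_energy avg l0) muleA -EFinM -exprSr.
- move=> k ks k0 ksE.
  have [k' k'E] := pushforward_exists k (measurable_orbit 0 s).
  rewrite (nuM k k' k0 (fun A _ => k'E A)).
  rewrite (branch_average_mutual (k' := ks) avg l0).
  - by rewrite muleA -EFinM -exprSr.
  - rewrite k'E; apply: subset_measure0 k0.
    + rewrite -[X in measurable X]setTI; apply: measurable_orbit => //.
      exact: measurable_level_setC.
    + exact: measurable_level_setC.
    + by move=> q /= nS S; apply: nS; exact: level_set_orbit.
  - by move=> A mA; rewrite k'E ksE.
move=> [//|b w] B [sw] mB.
pose C : set TR := [set p | (- r s / 2 < p) = b /\ B (step s p)].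
have mC : measurable C.
  have -> : C = [set p : TR | (- r s / 2 < p) = b] `&` step s @^-1` B by [].
  apply: measurableI; last by rewrite -[X in measurable X]setTI; exact: measurable_step.
  case: b @C => C.
    rewrite (_ : [set _ | _] = `]- r s / 2, +oo[%classic :> set TR)//.
    by apply/seteqP; split=> q /=; rewrite in_itv/= andbT.
  rewrite (_ : [set _ | _] = `]-oo, - r s / 2]%classic :> set TR)//.
  by apply/seteqP; split=> q /=; rewrite in_itv/= leNgt; [move=> ->|move/negbTE].
have -> : cell (b :: w) `&` orbit 0 s.+1 @^-1` B = cell w `&` orbit 0 s @^-1` C.
  rewrite cell_cons sw -setIA; congr (_ `&` _).
rewrite nuC// (branch_averageE _ avg) exprSr EFinM -muleA; congr (_ * (_ * _))%E.
have brE b' : l (branch s b' @^-1` C) = if b' == b then l B else 0%E.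
  have mpre : measurable (branch s b' @^-1` C).
    by rewrite -[X in measurable X]setTI; exact: measurable_branch.
  have mS := measurable_level_set s.+1.
  case: eqP mpre => [->|b'b] mpre.
    apply: (eq_prob_supp mS l0) => // q Sq; rewrite /C /=.
    have gq := level_set_gt Sq.
    by rewrite branch_gt// step_branch ?ltW//; split=> [[]|].
  rewrite -(@measure0 _ _ _ l); apply: (eq_prob_supp mS l0) => // q Sq; rewrite /C /=.
  by rewrite branch_gt ?(level_set_gt)//; split=> // -[].
by rewrite !brE; case: b {C mC brE} => /=; rewrite ?adde0 ?add0e.
Qed.

(** Finiteness of the energy of the image measure, needed in order to cancel mutual
energies. *)
Lemma mutual_orbit_le s k (ks : probability TR R) : k (~` level_set 0) = 0%E ->
  (forall A, measurable A -> ks A = k (orbit 0 s @^-1` A)) ->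
  ks (~` level_set s) = 0%E /\ (mutual ks ks <= (2 ^+ s)%:E * mutual k k)%E.
Proof.
move=> k0; have supp t (kt : probability TR R) :
    (forall A, measurable A -> kt A = k (orbit 0 t @^-1` A)) ->
    kt (~` level_set t) = 0%E.
  move=> ->; last exact: measurable_level_setC.
  apply: subset_measure0 k0.
  - rewrite -[X in measurable X]setTI; apply: measurable_orbit => //.
    exact: measurable_level_setC.
  - exact: measurable_level_setC.
  - by move=> q /= nS S; apply: nS; exact: level_set_orbit.
move=> ksE; split; first exact: supp.
elim: s ks ksE => [|s IH] ks ksE.
  rewrite expr0 mul1e (_ : mutual ks ks = mutual k k)//.
  have ek A : measurable A -> ks A = k A by move=> mA; rewrite ksE.
  rewrite {1}/mutual; transitivity (\int[k]_x \int[ks]_y log_ker (x - y))%E.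
    by apply: eq_measure_integral => A mA _; exact: ek.
  by apply: eq_integral => x _; apply: eq_measure_integral => A mA _; exact: ek.
have [k' k'E] := pushforward_exists k (measurable_orbit 0 s).
have k'0 := supp s k' (fun A _ => k'E A).
have k'ks A : measurable A -> ks A = k' (step s @^-1` A).
  by move=> mA; rewrite ksE// k'E.
apply: (le_trans (mutual_step_le k'0 k'ks)).
rewrite exprS EFinM -muleA lee_pmul2l//.
exact: (IH k' (fun A _ => k'E A)).
Qed.

(** For the symmetrization nu of k at level s, the mutual energy of k and nu and the
energy of nu are both 2^-s times the energy of the image of k under P_{2^s}.  As k
minimizes the energy, [eq_prob_of_energy] gives k = nu. *)
Lemma minimizer_cell k : k (~` level_set 0) = 0%E -> (mutual k k < +oo)%E ->
  (forall m : probability TR R, m (~` level_set 0) = 0%E -> mutual k k <= mutual m m)%E ->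
  forall w, k (cell w) = (2^-1 ^+ size w)%:E.
Proof.
move=> k0 kfin kmin w; set s := size w.
have [ks ksE] := pushforward_exists k (measurable_orbit 0 s).
have [ks0 ksle] := mutual_orbit_le k0 (fun A _ => ksE A).
have [nu [nu0 nuE nuM nuC]] := lift_exists ks0.
have knu : mutual k nu = mutual nu nu by rewrite (nuM k ks k0 (fun A _ => ksE A)).
have nufin : (mutual k nu < +oo)%E.
  rewrite knu nuE lte_mul_pinfty ?lee_fin ?exprn_ge0 ?invr_ge0//.
  by rewrite (le_lt_trans ksle)// lte_mul_pinfty ?lee_fin ?exprn_ge0.
have sub1 : ~` `[-1, 0]%classic `<=` ~` level_set 0.
  by apply: subsetC => q /level_setB; rewrite /= in_itv.
have supp1 (m : probability TR R) : m (~` level_set 0) = 0%E -> m (~` `[-1, 0]%classic) = 0%E.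
  move=> m0; apply: subset_measure0 m0 => //; first exact: measurableC.
  exact: measurable_level_setC.
rewrite (eq_prob_of_energy (supp1 _ k0) (supp1 _ nu0) nufin); last exact: measurable_cell.
  have := nuC w setT erefl measurableT.
  by rewrite preimage_setT setIT probability_setT mule1.
by rewrite knu mule_natl mule2n leeD2r// kmin.
Qed.

(** * From the plane to the line *)

Lemma level_set0E q : level_set 0 q <-> forall s, (cantor_poly gamma s).[1 + q] <= 0.
Proof.
have E s : (cantor_poly gamma s).[1 + q] = orbit 0 s.+1 q.
  by rewrite horner_cantor_poly addrAC subrr add0r.
split=> [Kq s|h n]; first by rewrite E; have /andP[] := Kq s.+1.
have rn := r_gt0 n; have := h n; rewrite E /= /step add0n => hn.
by apply/andP; split; rewrite leNgt; apply/negP => ?; nra.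
Qed.

Lemma cantor_setE (z : R[i]) : K z <-> level_set 0 (re1 z) /\ complex.Im z = 0.
Proof.
split=> [[x Kx <-]|[Kz iz]].
  split=> //; apply/level_set0E => s; rewrite /re1 /= addrC subrK.
  exact: (Kx s Logic.I).
exists (complex.Re z) => [s _|]; last by case: z iz {Kz} => a b /= ->.
by move/level_set0E : Kz => /(_ s); rewrite /re1 addrC subrK.
Qed.

Lemma cantor_set_emb q : level_set 0 q -> K (emb q).
Proof. by move=> Kq; apply/cantor_setE; rewrite re1_emb. Qed.

Lemma cantor_set_real (z : R[i]) : K z -> z = emb (re1 z).
Proof.
move=> /cantor_setE[_]; rewrite /emb /re1 addrC subrK.
by case: z => a b /= ->.
Qed.

Lemma measurable_cantor_set : measurable (K : set TC).
Proof.
rewrite (_ : K = re1 @^-1` level_set 0 `&` (fun z : TC => complex.Im z : TR) @^-1` [set 0]).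
  apply: measurableI.
    rewrite -[X in measurable X]setTI; apply: measurable_re1 => //.
    exact: measurable_level_set.
  rewrite -[X in measurable X]setTI; apply: measurable_Im => //; exact: measurable_set1.
by apply/seteqP; split=> z /cantor_setE.
Qed.

(** The set is real and has diameter one, so the logarithm is not truncated. *)
Lemma log_kernel_cantor z w : K z -> K w -> log_kernel z w = log_ker (re1 z - re1 w).
Proof.
move=> Kz Kw.
have /andP[z1 z2] := level_setB ((cantor_setE z).1 Kz).1.
have /andP[w1 w2] := level_setB ((cantor_setE w).1 Kw).1.
move: z1 w1; rewrite /= => z1 w1.
rewrite (cantor_set_real Kz) (cantor_set_real Kw) !re1_emb log_kernel_gap /gap /emb /=.
rewrite -rmorphB /= cabs_real.
have -> : 1 + re1 z - (1 + re1 w) = re1 z - re1 w by ring.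
rewrite /log_ker normr_eq0; case: ifP => // h; rewrite max_r// oppr_ge0 ln_le0//.
by rewrite ler_norml; apply/andP; split; lra.
Qed.

Section Law.
Variables (mu : probability TC R) (k : probability TR R).
Hypothesis mu_supp : mu (~` K) = 0%E.
Hypothesis kE : forall A, measurable A -> k A = mu (re1 @^-1` A).

Lemma law_supp : k (~` level_set 0) = 0%E.
Proof.
have mS := measurable_level_setC 0.
rewrite kE//; apply: subset_measure0 mu_supp.
- by rewrite -[X in measurable X]setTI; exact: measurable_re1.
- by apply: measurableC; exact: measurable_cantor_set.
- by move=> z /= nS Kz; apply: nS; have [] := (cantor_setE z).1 Kz.
Qed.

Lemma log_potential_cantor z : K z -> log_potential mu z = potential k (re1 z).
Proof.
move=> Kz; rewrite /potential (ge0_integral_law measurable_re1 kE); last 2 first.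
- exact: (measurable_log_ker1 (re1 z) (@measurable_id _ TR setT)).
- by move=> y; exact: log_ker_ge0.
apply: ae_eq_integral => //.
- exact: (measurableT_comp measurable_log_kernel (pair1_measurable (z : TC))).
- exact: (measurableT_comp
    (measurable_log_ker1 (re1 z) (@measurable_id _ TR setT)) measurable_re1).
exists (~` K); split=> //; first by apply: measurableC; exact: measurable_cantor_set.
by move=> w /= nzw Kw; apply: nzw => _; exact: log_kernel_cantor.
Qed.

Lemma log_energy_mutual : log_energy mu = mutual k k.
Proof.
rewrite /mutual (ge0_integral_law measurable_re1 kE (measurable_potential k) (potential_ge0 k)).
apply: ae_eq_integral => //.
- exact: measurable_log_potential.
- exact: (measurableT_comp (measurable_potential k) measurable_re1).
exists (~` K); split=> //; first by apply: measurableC; exact: measurable_cantor_set.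
by move=> w /= nzw Kw; apply: nzw => _; exact: log_potential_cantor.
Qed.

End Law.

(** Every competitor on the line is also a competitor in the plane. *)
Lemma embedding_exists (k : probability TR R) : k (~` level_set 0) = 0%E ->
  exists mu : probability TC R, supported_on K mu /\ log_energy mu = mutual k k.
Proof.
move=> k0; have [mu muE] := pushforward_exists k measurable_emb; exists mu.
have mu0 : supported_on K mu.
  have mS := measurable_level_setC 0.
  rewrite /supported_on muE; apply: subset_measure0 k0 => //.
    rewrite -[X in measurable X]setTI; apply: measurable_emb => //.
    by apply: measurableC; exact: measurable_cantor_set.
  by move=> q /= nK Kq; apply: nK; exact: cantor_set_emb.
split=> //; apply: log_energy_mutual => // A mA.
by rewrite muE -comp_preimage; congr (k _); apply/seteqP; split=> q /=; rewrite re1_emb.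
Qed.

Lemma non_polar_energy : non_polar K ->
  exists mu : probability TC R, supported_on K mu /\ (log_energy mu < +oo)%E.
Proof.
rewrite /non_polar /log_capacity => h.
have [_ [mu muK <-] mu0] := ereal_sup_gt h.
exists mu; split=> //; rewrite ltey; apply/eqP => E; move: mu0.
by rewrite E /= ltxx.
Qed.

Definition ccell (w : seq bool) : set TC := re1 @^-1` cell w.

Lemma measurable_ccell w : measurable (ccell w).
Proof.
by rewrite -[X in measurable X]setTI; apply: measurable_re1 => //; exact: measurable_cell.
Qed.

Lemma equilibrium_cell (mu : probability TC R) :
  non_polar K -> is_equilibrium_measure K mu ->
  forall w, mu (ccell w) = (2^-1 ^+ size w)%:E.
Proof.
move=> /non_polar_energy[mu1 [mu1K fin]] [muK mu_min] w.
have [k kE] := pushforward_exists mu measurable_re1.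
have kE' A : measurable A -> k A = mu (re1 @^-1` A) by move=> _; exact: kE.
have muk := log_energy_mutual muK kE'.
rewrite /ccell -kE; apply: minimizer_cell => //.
- exact: law_supp muK kE'.
- by rewrite -muk (le_lt_trans (mu_min _ mu1K)).
- move=> m /embedding_exists[nu [nuK <-]]; rewrite -muk; exact: mu_min.
Qed.

(** * The gauge function *)

Lemma delta_scale (t : R) : 0 < t <= 1 -> exists n, delta n.+1 < t <= delta n.
Proof.
move=> /andP[t0 t1].
case: (ex_minnP (delta_small t0)) => -[|n] dn min; first by move: dn; rewrite delta0 ltNge t1.
exists n; rewrite dn /= leNgt; apply/negP => /min; by rewrite ltnn.
Qed.

Lemma delta_scale_uniq (t : R) m n :
  delta m.+1 < t <= delta m -> delta n.+1 < t <= delta n -> m = n.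
Proof.
have aux i j : delta i.+1 < t <= delta i -> delta j.+1 < t <= delta j -> (i <= j)%N.
  move=> /andP[_ ti] /andP[tj _]; rewrite leqNgt; apply/negP => ji.
  have := delta_anti ji => dij.
  by have := lt_le_trans tj (le_trans ti dij); rewrite ltxx.
by move=> h1 h2; apply/eqP; rewrite eqn_leq !aux.
Qed.

Lemma cantor_etaE (t : R) n : delta n.+1 < t <= delta n ->
  cantor_eta gamma t = n%:R + ln (delta n / t) / ln (delta n / delta n.+1).
Proof.
move=> tn; rewrite /cantor_eta; set P := [set s | _].
have Pn : P n by exact: tn.
by have /delta_scale_uniq/(_ tn) -> := xgetI 0%N Pn.
Qed.

Lemma delta_le1 s : delta s <= 1.
Proof. by rewrite -delta0 delta_anti. Qed.

Lemma cantor_h_delta s : h (delta s) = 2^-1 ^+ s.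
Proof.
have d0 := delta_gt0 s.
rewrite /cantor_h ifF ?ifT ?delta_le1//; last by rewrite leNgt d0.
rewrite (@cantor_etaE _ s); last first.
  by rewrite lexx deltaS_lt.
by rewrite divff ?gt_eqF// ln1 mul0r addr0 powRN powR_mulrn// exprVn.
Qed.

(** The function eta is at most n + 1 on the n-th scale. *)
Lemma cantor_h_ge (t : R) n : delta n.+1 < t <= delta n -> 2^-1 ^+ n.+1 <= h t.
Proof.
move=> tn; have /andP[t1 t2] := tn.
have t0 : 0 < t by apply: lt_trans t1; exact: delta_gt0.
have d1 := delta_gt0 n.+1; have d0 := delta_gt0 n.
rewrite /cantor_h ifF ?ifT ?(le_trans t2 (delta_le1 n))//; last by rewrite leNgt t0.
rewrite (cantor_etaE tn) exprVn -powR_mulrn// -powRN ler_powR ?ler1n// lerN2.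
rewrite -natr1 lerD2l ler_pdivrMr ?mul1r; last first.
  by rewrite ln_gt0// ltr_pdivlMr// mul1r deltaS_lt.
rewrite ler_ln ?posrE ?divr_gt0// ler_pM2l// lef_pV2 ?posrE// ltW//.
Qed.

Lemma cantor_h_ge0 t : 0 <= h t.
Proof. by rewrite /cantor_h; case: ifP => // _; case: ifP => // _; exact: powR_ge0. Qed.

Lemma cantor_h0 : h 0 = 0.
Proof. by rewrite /cantor_h lexx. Qed.

(** * Comparison with the Hausdorff measure *)

Section EquidistributedMeasure.
Variable mu : probability TC R.
Hypothesis muK : mu (~` K) = 0%E.
Hypothesis mu_cell : forall w, mu (ccell w) = (2^-1 ^+ size w)%:E.

Lemma mu_setIK A : measurable A -> mu A = mu (A `&` K).
Proof.
move=> mA; apply: (eq_prob_supp (measurable_cantor_set) muK) => //.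
  by apply: measurableI => //; exact: measurable_cantor_set.
by move=> z Kz; split=> [Az|[]].
Qed.

(** Points of the set in a ball of radius t <= delta_n are less than 2 delta_n apart, so
[cell_gap] puts them in one cell of level n, of mass 2^-n <= 2 h(t). *)
Lemma mu_ball_le (z : (R[i])^o) (t : R) : 0 <= t <= 1 ->
  (mu (ball z t%:C) <= (2 * h t)%:E)%E.
Proof.
rewrite le_eqVlt => /andP[/orP[/eqP <- _|t0 t1]].
  rewrite cantor_h0 mulr0 (_ : ball _ _ = set0) ?measure0//.
  apply/seteqP; split=> w // /ball_cabs; rewrite ltNge => /negP; apply.
  exact: sqrtr_ge0.
have [|n tn] := delta_scale (t := t); first by rewrite t0.
have mB := measurable_ballC z t.
rewrite mu_setIK//.
have [->|/set0P[p [zp Kp]]] := eqVneq (ball z t%:C `&` K) set0.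
  by rewrite measure0 lee_fin mulr_ge0// cantor_h_ge0.
apply: (@le_trans _ _ (mu (ccell (word n (re1 p))))).
  apply: le_measure; rewrite ?inE.
  - by apply: measurableI => //; exact: measurable_cantor_set.
  - exact: measurable_ccell.
  move=> q [zq Kq]; rewrite /ccell /cell /= size_word.
  have Kp0 := ((cantor_setE p).1 Kp).1.
  have Kq0 := ((cantor_setE q).1 Kq).1.
  apply: contrapT => pq; have := cell_gap Kq0 Kp0 pq.
  move/ball_cabs : zp => zp; move/ball_cabs : zq => zq.
  have := re1_cabs q p; have := cabs_triangle q z p; rewrite (cabs_sym q z).
  by have := delta_gt0 n; case/andP: tn; lra.
rewrite mu_cell size_word lee_fin.
have := cantor_h_ge tn; rewrite exprS; lra.
Qed.

(** The mass distribution principle: by [mu_ball_le] no ball of a cover carries more than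
twice its gauge. *)
Lemma mu_le_content A (d : R) : measurable A -> 0 < d <= 1 ->
  ((2^-1)%:E * mu A <= hausdorff_content h d (A `&` K))%E.
Proof.
move=> mA /andP[d0 d1].
apply: le_ereal_inf_tmp => _ [t [td [z cov]] <-].
rewrite lee_pdivrMl// -nneseriesZl//; last first.
  by move=> j _; rewrite lee_fin cantor_h_ge0.
rewrite mu_setIK//.
have t1 j : 0 <= t j <= 1.
  by have /andP[a b] := td j; rewrite a (le_trans b).
apply: (@le_trans _ _ (\sum_(0 <= j <oo) mu (ball (z j) (t j)%:C))%E).
  apply: measure_sigma_subadditive => //.
  - by move=> j; exact: measurable_ballC.
  - by apply: measurableI => //; exact: measurable_cantor_set.
apply: lee_nneseries => // j _; rewrite -EFinM; exact: mu_ball_le.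
Qed.

Lemma content_anti A (d e : R) : d <= e ->
  (hausdorff_content h e A <= hausdorff_content h d A)%E.
Proof.
move=> de; apply: ereal_inf_le_tmp; apply: image_subset => t [td cov]; split=> // j.
by have /andP[-> /le_trans] := td j; exact.
Qed.

(** The content increases as the bound on the radii decreases, so the lower bound by
the mass passes to the limit. *)
Lemma equidistributed_dominated : mu `<< hausdorff_measure_on K h.
Proof.
move=> N N0 A mA AN; have := N0 A mA AN; rewrite /hausdorff_measure_on => H0.
have cv : cvg (hausdorff_content h d (A `&` K) @[d --> 0^'+]).
  apply: nonincreasing_at_right_is_cvge; near=> x => a b _ _; exact: content_anti.
suff : ((2^-1)%:E * mu A <= hausdorff_measure h (A `&` K))%E.
  rewrite H0 lee_pdivrMl// mule0 => le0; apply/eqP; rewrite eq_le le0/=; exact: measure_ge0.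
apply: lime_ge => //; near=> d.
apply: mu_le_content => //.
by apply/andP; split; near: d; [exact: nbhs_right_gt|exact: nbhs_right_le].
Unshelve. all: by end_near. Qed.

Section MaximalCells.
Local Notation K0 := (level_set 0).
Variable m : nat.
Hypothesis diam : forall s q p, K0 q -> K0 p ->
  word (s + m) q = word (s + m) p -> `|q - p| < delta s.

Lemma word_behead_eq s t q p : (t <= s)%N -> word s q = word s p -> word t q = word t p.
Proof.
move=> ts; rewrite -(subnK ts); elim: (s - t)%N => // n IH.
by rewrite addSn => /wordS_eq[_]; exact: IH.
Qed.

Definition cell0 (w : seq bool) : set R := cell w `&` K0.

(** At level s0 the parent is exempted, being below the admissible levels. *)
Definition maximal_cell (s0 : nat) (U : set R) (w : seq bool) : Prop :=
  [/\ (s0 <= size w)%N, cell0 w !=set0, cell0 w `<=` U &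
      size w = s0 \/ ~ (cell0 (behead w) `<=` U)].

(** Cells shrink to points, so the cells around a point of an open set are eventually
contained in it, and the first such cell is maximal. *)
Lemma maximal_cell_exists s0 (U : set R) q : open U -> U q -> K0 q ->
  exists s, maximal_cell s0 U (word s q).
Proof.
move=> oU Uq Kq.
have [e e0 eU] : exists2 e : R, 0 < e & forall p, `|q - p| < e -> U p.
  have /nbhs_ballP[e /= e0 eU] : nbhs q U by exact: open_nbhs_nbhs.
  by exists e => // p qp; apply: eU; rewrite -ball_normE.
have ex : exists s, (s0 <= s)%N && `[< cell0 (word s q) `<=` U >].
  have [n dn] := delta_small e0.
  exists (maxn s0 n + m)%N; rewrite (leq_trans (leq_maxl s0 n) (leq_addr _ _)) /=.
  apply/asboolP => p [cp Kp]; apply: eU.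
  apply: (lt_le_trans _ (le_trans (delta_anti (leq_maxr s0 n)) (ltW dn))).
  apply: diam => //.
  by move: cp; rewrite /cell /= size_word.
case: (ex_minnP ex) => s /andP[s0s /asboolP cU] min; exists s.
split; rewrite ?size_word//; first by exists q; split=> //; rewrite /cell /= size_word.
have [->|ne] := eqVneq s s0; first by left.
right; case: s s0s cU min ne => [|s] s0s cU min ne.
  by move: s0s ne; rewrite leqn0 => /eqP->; rewrite eqxx.
move=> cU'; have : (s < s)%N; last by rewrite ltnn.
apply: min; apply/andP; split; last exact/asboolP.
by move: s0s; rewrite leq_eqVlt eq_sym (negbTE ne) ltnS.
Qed.

(** Two cells that meet are nested, and the parent of the smaller one lies in the
larger one. *)
Lemma maximal_cell_inj s0 U w w' q : maximal_cell s0 U w -> maximal_cell s0 U w' ->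
  cell0 w q -> cell0 w' q -> w = w'.
Proof.
have aux v v' : maximal_cell s0 U v -> maximal_cell s0 U v' ->
    cell0 v q -> cell0 v' q -> (size v' <= size v)%N.
  move=> [s0v _ vU _] [s0v' _ _ [->//|nU]] [vq Kq] [v'q _].
  rewrite leqNgt; apply/negP => vv'; apply: nU => p [cp Kp]; apply: vU; split=> //.
  have sv' : size v' = (size v').-1.+1 by rewrite prednK// (leq_ltn_trans _ vv').
  have bv' : behead v' = word (size v').-1 q.
    by rewrite -v'q sv' /= size_word.
  move: cp; rewrite /cell /= size_behead bv' => cp.
  rewrite -[RHS]vq; apply: word_behead_eq cp.
  by rewrite -ltnS -sv'.
move=> M M' cw cw'; have sE : size w = size w'.
  by apply/eqP; rewrite eqn_leq (aux w' w)// (aux w w').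
by move: cw cw' => [wq _] [w'q _]; rewrite -wq -w'q sE.
Qed.

Variable k : probability TR R.
Hypothesis k_cell : forall w, k (cell w) = (2^-1 ^+ size w)%:E.
Hypothesis k_supp : k (~` K0) = 0%E.

Lemma mass_cell0 w : k (cell0 w) = (2^-1 ^+ size w)%:E.
Proof.
rewrite -k_cell; apply: (eq_prob_supp (measurable_level_set 0) k_supp).
- by apply: measurableI; [exact: measurable_cell|exact: measurable_level_set].
- exact: measurable_cell.
- by move=> q Kq; split=> [[]|].
Qed.

Lemma measurable_cell0 w : measurable (cell0 w : set TR).
Proof. by apply: measurableI; [exact: measurable_cell|exact: measurable_level_set]. Qed.

(** The maximal cells in U cover A and are disjoint.  A cell of level n + m fits in a
ball of radius delta_n, whose gauge 2^-n is 2^m times the mass of the cell. *)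
Lemma content_le_open (A : set R[i]) (U : set R) (d : R) : 0 < d -> open U ->
  A `<=` K -> (forall z, A z -> U (re1 z)) ->
  (hausdorff_content h d A <= (2 ^+ m)%:E * k U)%E.
Proof.
move=> d0 oU AK AU.
have [n0 /ltW dn0] := delta_small d0.
(* from level s0 on, delta (size w - m) is an admissible radius *)
pose s0 := (n0 + m)%N; pose good := maximal_cell s0 U.
(* words are enumerated through their codes; the indices that code nothing useful
   get radius 0, which adds nothing to the cover and costs nothing *)
pose C (j : nat) : set TR :=
  if (pickle_inv j : option (seq bool)) is Some w
  then if `[< good w >] then cell0 w else set0 else set0.
pose t (j : nat) : R :=
  if (pickle_inv j : option (seq bool)) is Some w
  then if `[< good w >] then delta (size w - m) else 0 else 0.
pose z (j : nat) : (R[i])^o :=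
  if (pickle_inv j : option (seq bool)) is Some w then (1 + xget 0 (cell0 w))%:C else 0.
have size_good w : good w -> size w = (size w - m + m)%N /\ (n0 <= size w - m)%N.
  move=> [+ _ _ _]; rewrite /s0 => sw; split.
    by rewrite subnK// (leq_trans _ sw)// leq_addl.
  by rewrite leq_subRL ?(leq_trans _ sw) ?leq_addl// addnC.
have htC j : ((h (t j))%:E = (2 ^+ m)%:E * k (C j))%E.
  rewrite /t /C; case: (pickle_inv j) => [w|]; last by rewrite cantor_h0 measure0 mule0.
  case: asboolP => [gw|_]; last by rewrite cantor_h0 measure0 mule0.
  rewrite cantor_h_delta// mass_cell0 -EFinM; congr EFin.
  have [sE _] := size_good _ gw.
  by rewrite [in RHS]sE exprD mulrCA -exprMn divff// expr1n mulr1.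
have mC j : measurable (C j).
  rewrite /C; case: (pickle_inv j) => [w|//]; case: asboolP => // _; exact: measurable_cell0.
have tC : trivIset setT C.
  apply/trivIsetP => i j _ _ ij; apply/seteqP; split=> // q [].
  rewrite /C; case Ei : (pickle_inv i) => [w|//]; case: asboolP => // gw wq.
  case Ej : (pickle_inv j) => [w'|//]; case: asboolP => // gw' w'q.
  have ww' := maximal_cell_inj gw gw' wq w'q.
  move/eqP : ij; apply; have := @pickle_invK (seq bool) i; rewrite Ei /= => <-.
  by have := @pickle_invK (seq bool) j; rewrite Ej /= => <-; rewrite ww'.
have CU : \bigcup_j C j `<=` U.
  move=> q [j _]; rewrite /C; case: (pickle_inv j) => [w|//].
  by case: asboolP => // -[_ _ wU _] /wU.
have sum_le : (\sum_(0 <= j <oo) k (C j) <= k U)%E.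
  rewrite -measure_semi_bigcup//; last exact: bigcup_measurable.
  apply: le_measure; rewrite ?inE//; first exact: bigcup_measurable.
  exact: open_measurable.
apply: (@le_trans _ _ (\sum_(0 <= j <oo) (h (t j))%:E)%E); last first.
  under eq_eseriesr do rewrite htC.
  rewrite nneseriesZl// lee_pmul2l// lte_fin exprn_gt0//.
apply: ereal_inf_lbound; exists t => //; split.
  move=> j; rewrite /t; case: (pickle_inv j) => [w|]; last by rewrite lexx ltW.
  case: asboolP => [gw|_]; last by rewrite lexx ltW.
  rewrite (ltW (delta_gt0 _))//= (le_trans _ dn0)// delta_anti//.
  by have [] := size_good _ gw.
exists z => x Ax; have Kx := AK _ Ax.
have Kq := ((cantor_setE x).1 Kx).1.
have [s gs] := maximal_cell_exists s0 oU (AU _ Ax) Kq.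
exists (pickle (word s (re1 x))) => //; rewrite /z /t pickleK_inv.
case: asboolP => // _; apply/ball_cabs.
rewrite {2}(cantor_set_real Kx) /emb -rmorphB /= cabs_real.
set p := xget 0 _; have [cp Kp] : cell0 (word s (re1 x)) p.
  by have [_ [p0 cp0] _ _] := gs; exact: (xgetI 0 cp0).
rewrite (_ : 1 + p - _ = p - re1 x); last by ring.
have [sE _] := size_good _ gs.
by apply: diam => //; rewrite -sE; move: cp; rewrite /cell /= size_word => ->.
Qed.

End MaximalCells.

Lemma content_ge0 (d : R) A : (0 <= hausdorff_content h d A)%E.
Proof.
apply: le_ereal_inf_tmp => _ [t _ <-]; apply: nneseries_ge0 => j _ _.
by rewrite lee_fin cantor_h_ge0.
Qed.

Lemma content_null A (d : R) : measurable A -> mu A = 0%E -> 0 < d ->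
  hausdorff_content h d (A `&` K) = 0%E.
Proof.
move=> mA muA d0; have [m diam] := cell_diam_uniform.
have [k kE] := pushforward_exists mu measurable_re1.
have kE' B : measurable B -> k B = mu (re1 @^-1` B) by move=> _; exact: kE.
have k0 := law_supp muK kE'.
have k_cell w : k (cell w) = (2^-1 ^+ size w)%:E by rewrite kE; exact: mu_cell.
pose A' : set TR := emb @^-1` A.
have mA' : measurable A' by rewrite -[X in measurable X]setTI; exact: measurable_emb.
have kA' : k A' = 0%E.
  rewrite kE -muA; apply: (eq_prob_supp (measurable_cantor_set) muK) => //.
    by rewrite -[X in measurable X]setTI; exact: measurable_re1.
  by move=> z Kz; rewrite /A' /= -(cantor_set_real Kz).
apply/eqP; rewrite eq_le content_ge0 andbT; apply/lee_addgt0Pr => e e0; rewrite add0e.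
have m0 : 0 < 2 ^+ m :> R by rewrite exprn_gt0.
have [U [oU AU kU]] := null_set_open_cover mA' kA' (divr_gt0 e0 m0).
have ccle := @content_le_open m diam k k_cell k0 (A `&` K) U d d0 oU.
apply: le_trans (ccle _ _) _.
- by move=> z [].
- move=> z [Az Kz]; apply: AU; rewrite /A' /=.
  by rewrite -(cantor_set_real Kz).
apply: (@le_trans _ _ ((2 ^+ m)%:E * (e / 2 ^+ m)%:E)%E).
  by rewrite lee_pmul2l// lte_fin.
by rewrite -EFinM mulrC divfK ?gt_eqF.
Qed.

Lemma hausdorff_dominated : hausdorff_measure_on K h `<< mu.
Proof.
move=> N N0 A mA AN; rewrite /hausdorff_measure_on /hausdorff_measure.
apply: cvg_lim => //; apply: cvg_near_cst; near=> d.
by apply: content_null (N0 A mA AN) _ => //; near: d; exact: nbhs_right_gt.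
Unshelve. all: by end_near. Qed.

End EquidistributedMeasure.

End CantorSet.

Theorem theorem3p5 (R : realType) (gamma : nat -> R)
  (gamma_bound : forall s : nat, (1 <= s)%N -> 0 < gamma s <= 1 / 32)
  (gamma_summable : (\sum_(1 <= s <oo) (gamma s)%:E < +oo)%E)
  (K_non_polar : non_polar (cantor_set gamma))
  (mu : probability (borelC R) R)
  (mu_equilibrium : is_equilibrium_measure (cantor_set gamma) mu) :
  mu `<< hausdorff_measure_on (cantor_set gamma) (cantor_h gamma) /\
  hausdorff_measure_on (cantor_set gamma) (cantor_h gamma) `<< mu.
Proof.
have muK := mu_equilibrium.1.
have mu_cell := equilibrium_cell gamma_bound K_non_polar mu_equilibrium.
split; first exact: (@equidistributed_dominated R gamma gamma_bound mu muK mu_cell).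
exact: (@hausdorff_dominated R gamma gamma_bound gamma_summable mu muK mu_cell).
Qed.
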